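(* Let $G$ be a compact abelian group with (discrete) dual group $\hat G$ and let $\lambda\colon \hat G\to\mathbb R_{>0}$ be a strictly positive function with $\lambda\in L^1(\hat G)$ (i.e. $\sum_{\gamma\in\hat G}\lambda(\gamma)<\infty$). Let $$\mathcal H=\Big\{\hat{\mathcal F}\hat f\in C(G)\ :\ \sum_{\gamma\in\hat G}\frac{|\hat f(\gamma)|^2}{\lambda(\gamma)}<\infty\Big\},\qquad \langle f,g\rangle_{\mathcal H}=\sum_{\gamma\in\hat G}\frac{\hat f(\gamma)\overline{\hat g(\gamma)}}{\lambda(\gamma)},$$ $$k_x(y)=\sum_{\gamma\in\hat G}\lambda(\gamma)\overline{\gamma(x)}\gamma(y),\qquad x,y\in G.$$ Then $\mathcal H$ is a reproducing kernel Hilbert space on $G$ with kernel sections $k_x$, and its kernel function is strictly positive definite. Furthermore, $\mathcal H$ is a reproducing kernel Hilbert algebra (RKHA) if and only if $\lambda$ is subconvolutive, i.e. there is a constant $C$ with $(\lambda*\lambda)(\gamma)\le C\lambda(\gamma)$ for all $\gamma\in\hat G$.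
   Context: For a set $X$, $\mathcal L(X)$ is the space of complex-valued functions on $X$. A reproducing kernel Hilbert space (RKHS) on $X$ is a vector subspace $\mathcal H\subset\mathcal L(X)$ with an inner product (linear in the first argument) making it a Hilbert space on which every point evaluation is continuous; $k_x\in\mathcal H$ is the kernel section with $f(x)=\langle f,k_x\rangle$ for all $f\in\mathcal H$, and $k(x,y)=\langle k_y,k_x\rangle$. A kernel $k$ is strictly positive definite if $\sum_{i,j}c_ik(x_i,x_j)\overline{c_j}>0$ for all distinct $x_1,\dots,x_n\in X$ and $c_1,\dots,c_n\in\mathbb C$ not all zero. An RKHS $\mathcal H$ is an RKHA if the map $k_x\mapsto k_x\otimes k_x$ ($x\in X$) extends to a bounded linear operator $\Delta\colon\mathcal H\to\mathcal H\otimes\mathcal H$ (Hilbert space tensor product); equivalently, pointwise multiplication extends to a bounded linear operator $\mathcal H\otimes\mathcal H\to\mathcal H$. Here $\hat{\mathcal F}\hat f(x)=\sum_{\gamma\in\hat G}\hat f(\gamma)\gamma(x)$ for $\hat f\in L^1(\hat G)$ is the Fourier transform on $\hat G$ (counting measure), for $f=\hat{\mathcal F}\hat f$ the function $\hat f$ denotes its Fourier coefficients, and $(\lambda*\lambda)(\gamma)=\sum_{\alpha\in\hat G}\lambda(\alpha)\lambda(\gamma-\alpha)$. *)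

(* Defs.v *)
From HB Require Import structures.
From mathcomp Require Import all_boot all_order all_algebra complex.
From mathcomp Require Import all_classical all_reals all_analysis.

Set Implicit Arguments.
Unset Strict Implicit.
Unset Printing Implicit Defensive.

Import Order.TTheory GRing.Theory Num.Theory.
Import numFieldNormedType.Exports.

Local Open Scope classical_set_scope.
Local Open Scope ring_scope.
Local Open Scope complex_scope.

(* The norm of R[i] takes values in R[i]; this is its real-valued version. *)
Definition cabs (R : realType) (z : R[i]) : R := complex.Re `|z|.

(* Unordered sums over an arbitrary index type, i.e. integrals for the
   counting measure; meaningful on absolutely summable families only. *)
Definition rsum (R : realType) (I : choiceType) (f : I -> R) : R :=
  fine (\esum_(i in [set: I]) ((fun j => (f j)%:E)^\+ i))%E
  - fine (\esum_(i in [set: I]) ((fun j => (f j)%:E)^\- i))%E.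

Definition csum (R : realType) (I : choiceType) (f : I -> R[i]) : R[i] :=
  rsum (fun i => complex.Re (f i)) +i* rsum (fun i => complex.Im (f i)).

Definition in_L1 (R : realType) (I : choiceType) (f : I -> R[i]) : Prop :=
  (\esum_(i in [set: I]) (cabs (f i))%:E < +oo)%E.

Definition ip_norm (R : realType) (L : lmodType R[i]) (ip : L -> L -> R[i])
    (u : L) : R :=
  Num.sqrt (complex.Re (ip u u)).

Definition ip_cauchy (R : realType) (L : lmodType R[i])
    (ip : L -> L -> R[i]) (u : nat -> L) : Prop :=
  forall e : R, 0 < e -> exists N : nat, forall m n : nat,
    (N <= m)%N -> (N <= n)%N -> ip_norm ip (u m - u n) < e.

(* A Hilbert space is a subset of an ambient vector space; the values of the
   inner product outside the subset are irrelevant. *)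
Record is_hilbert (R : realType) (L : lmodType R[i]) (H : set L)
    (ip : L -> L -> R[i]) : Prop := IsHilbert {
  hilbert_0 : H 0 ;
  hilbert_lin : forall (a : R[i]) u v, H u -> H v -> H (a *: u + v) ;
  ip_linear : forall (a : R[i]) u v w, H u -> H v -> H w ->
    ip (a *: u + v) w = a * ip u w + ip v w ;
  ip_conj : forall u v, H u -> H v -> ip v u = Num.conj (ip u v) ;
  ip_ge0 : forall u, H u -> 0 <= ip u u ;
  ip_eq0 : forall u, H u -> ip u u = 0 -> u = 0 ;
  hilbert_complete : forall u : nat -> L, (forall n, H (u n)) ->
    ip_cauchy ip u ->
    exists2 l : L, H l & (fun n => ip_norm ip (u n - l)) @ \oo --> (0 : R)
}.

Record is_bounded_linear (R : realType) (L1 L2 : lmodType R[i])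
    (H1 : set L1) (ip1 : L1 -> L1 -> R[i])
    (H2 : set L2) (ip2 : L2 -> L2 -> R[i]) (D : L1 -> L2) : Prop :=
  IsBoundedLinear {
  bl_map : forall u, H1 u -> H2 (D u) ;
  bl_linear : forall (a : R[i]) u v, H1 u -> H1 v ->
    D (a *: u + v) = a *: D u + D v ;
  bl_bounded : exists M : R, forall u, H1 u ->
    ip_norm ip2 (D u) <= M * ip_norm ip1 u
}.

(* (T, ipT) with the simple tensors [tau u v] is a completion of the algebraic
   tensor product of H1 and H2 for the inner product
   <u (x) v, u' (x) v'> = <u, u'> <v, v'>.  This determines the Hilbert space
   tensor product up to a unique unitary compatible with simple tensors. *)
Record is_hilbert_tensor (R : realType) (L1 L2 L : lmodType R[i])
    (H1 : set L1) (ip1 : L1 -> L1 -> R[i])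
    (H2 : set L2) (ip2 : L2 -> L2 -> R[i])
    (T : set L) (ipT : L -> L -> R[i]) (tau : L1 -> L2 -> L) : Prop :=
  IsHilbertTensor {
  tensor_hilbert : is_hilbert T ipT ;
  tensor_mem : forall u v, H1 u -> H2 v -> T (tau u v) ;
  tensor_linearl : forall (a : R[i]) u u' v, H1 u -> H1 u' -> H2 v ->
    tau (a *: u + u') v = a *: tau u v + tau u' v ;
  tensor_linearr : forall (a : R[i]) u v v', H1 u -> H2 v -> H2 v' ->
    tau u (a *: v + v') = a *: tau u v + tau u v' ;
  tensor_ip : forall u u' v v', H1 u -> H1 u' -> H2 v -> H2 v' ->
    ipT (tau u v) (tau u' v') = ip1 u u' * ip2 v v' ;
  tensor_dense : forall t, T t -> forall e : R, 0 < e ->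
    exists (n : nat) (u : 'I_n -> L1) (v : 'I_n -> L2),
      [/\ forall i, H1 (u i), forall i, H2 (v i)
        & ip_norm ipT (t - \sum_(i < n) tau (u i) (v i)) < e]
}.

(* The alias R[i]^o makes X -> R[i]^o the vector space of all complex-valued
   functions on X. *)

Definition eval_continuous (R : realType) (X : Type) (H : set (X -> R[i]^o))
    (ip : (X -> R[i]^o) -> (X -> R[i]^o) -> R[i]) (x : X) : Prop :=
  forall f, H f -> forall e : R, 0 < e -> exists2 d : R, 0 < d &
    forall g, H g -> ip_norm ip (g - f) < d -> cabs (g x - f x) < e.

Definition is_rkhs (R : realType) (X : Type) (H : set (X -> R[i]^o))
    (ip : (X -> R[i]^o) -> (X -> R[i]^o) -> R[i]) : Prop :=
  is_hilbert H ip /\ forall x : X, eval_continuous H ip x.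

Definition is_kernel_sections (R : realType) (X : Type)
    (H : set (X -> R[i]^o)) (ip : (X -> R[i]^o) -> (X -> R[i]^o) -> R[i])
    (k : X -> X -> R[i]^o) : Prop :=
  forall x : X, H (k x) /\ forall f, H f -> f x = ip f (k x).

Definition kernel_fun (R : realType) (X : Type)
    (ip : (X -> R[i]^o) -> (X -> R[i]^o) -> R[i]) (k : X -> X -> R[i]^o)
    (x y : X) : R[i] :=
  ip (k y) (k x).

Definition strictly_posdef (R : realType) (X : Type) (K : X -> X -> R[i]) :
    Prop :=
  forall (n : nat) (x : 'I_n -> X) (c : 'I_n -> R[i]),
    injective x -> (exists i, c i != 0) ->
    0 < \sum_(i < n) \sum_(j < n) c i * K (x i) (x j) * Num.conj (c j).

Definition is_rkha (R : realType) (X : Type) (H : set (X -> R[i]^o))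
    (ip : (X -> R[i]^o) -> (X -> R[i]^o) -> R[i]) : Prop :=
  is_rkhs H ip /\
  exists2 k : X -> X -> R[i]^o, is_kernel_sections H ip k &
  exists (L : lmodType R[i]) (T : set L) (ipT : L -> L -> R[i])
    (tau : (X -> R[i]^o) -> (X -> R[i]^o) -> L),
    is_hilbert_tensor H ip H ip T ipT tau /\
    exists2 Delta : (X -> R[i]^o) -> L,
      is_bounded_linear H ip T ipT Delta &
      forall x : X, Delta (k x) = tau (k x) (k x).

(* The group laws of both G and its dual are written additively, so that
   (alpha + beta) x = alpha x * beta x. *)

Definition is_character (R : realType) (G : topologicalZmodType)
    (chi : G -> R[i]^o) : Prop :=
  [/\ continuous chi, forall x, `|chi x| = 1
    & forall x y, chi (x + y) = chi x * chi y].

Definition dual (R : realType) (G : topologicalZmodType) : Type :=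
  set_type [set chi : G -> R[i]^o | is_character chi].

HB.instance Definition _ (R : realType) (G : topologicalZmodType) :=
  Choice.on (dual R G).

Definition char_fun (R : realType) (G : topologicalZmodType)
    (gamma : dual R G) : G -> R[i]^o := val gamma.
Coercion char_fun : dual >-> Funclass.

Section DualGroup.
Context (R : realType) (G : topologicalZmodType).
Implicit Types alpha beta gamma : dual R G.

Lemma char_funP gamma : is_character gamma.
Proof. exact: (set_mem (valP gamma)). Qed.

Lemma char_fun_inj : injective (@char_fun R G).
Proof. exact: val_inj. Qed.

Fact is_character1 : @is_character R G (fun=> 1).
Proof.
split=> [x|x|x y]; [exact: cvg_cst|exact: normr1|by rewrite mulr1].
Qed.

Fact is_characterM alpha beta :
  is_character (fun x => alpha x * beta x : R[i]^o).
Proof.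
have [ca na ma] := char_funP alpha; have [cb nb mb] := char_funP beta.
split=> [x|x|x y]; last by rewrite ma mb mulrACA.
- by apply: cvgM; [exact: ca|exact: cb].
- by rewrite normrM na nb mulr1.
Qed.

Fact is_characterN alpha : is_character (fun x => alpha (- x)).
Proof.
have [ca na ma] := char_funP alpha.
split=> [x|x|x y]; last by rewrite opprD ma.
- apply: (@continuous_comp G G R[i]^o -%R alpha x).
    exact: opp_continuous.
  exact: ca.
- exact: na.
Qed.

Definition dual_zero : dual R G := SigSub (mem_set is_character1).
Definition dual_opp alpha : dual R G := SigSub (mem_set (is_characterN alpha)).
Definition dual_add alpha beta : dual R G :=
  SigSub (mem_set (is_characterM alpha beta)).

Fact dual_addA : associative dual_add.
Proof.
by move=> a b c; apply/char_fun_inj/funext => x; rewrite /char_fun/= mulrA.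
Qed.

Fact dual_addC : commutative dual_add.
Proof.
by move=> a b; apply/char_fun_inj/funext => x; rewrite /char_fun/= mulrC.
Qed.

Fact dual_add0 : left_id dual_zero dual_add.
Proof.
by move=> a; apply/char_fun_inj/funext => x; rewrite /char_fun/= mul1r.
Qed.

Fact dual_addN : left_inverse dual_zero dual_opp dual_add.
Proof.
move=> a; apply/char_fun_inj/funext => x; rewrite /char_fun/=.
have [_ na ma] := char_funP a.
have a0 : a 0 = 1.
  have nz : a 0 != 0 by rewrite -normr_eq0 na oner_eq0.
  by apply: (mulfI nz); rewrite mulr1 -ma addr0.
by rewrite -[LHS]/(a (- x) * a x) -ma addNr a0.
Qed.

HB.instance Definition _ := GRing.isZmodule.Build (dual R G)
  dual_addA dual_addC dual_add0 dual_addN.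

End DualGroup.

Definition fourier (R : realType) (G : topologicalZmodType)
    (a : dual R G -> R[i]) : G -> R[i]^o :=
  fun x => csum (fun gamma : dual R G => a gamma * gamma x).

(* The Fourier coefficients of f: the (unique) absolutely summable family with
   Fourier transform f, and 0 if there is none. *)
Definition fcoef (R : realType) (G : topologicalZmodType) (f : G -> R[i]^o) :
    dual R G -> R[i] :=
  xget (fun=> 0) [set a : dual R G -> R[i] | in_L1 a /\ fourier a = f].

Definition harmonic_space (R : realType) (G : topologicalZmodType)
    (lambda : dual R G -> R) : set (G -> R[i]^o) :=
  [set f | continuous f /\ exists a : dual R G -> R[i],
    [/\ in_L1 a, f = fourier a &
      (\esum_(gamma in [set: dual R G])
         (cabs (a gamma) ^+ 2 / lambda gamma)%:E < +oo)%E]].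

Definition harmonic_ip (R : realType) (G : topologicalZmodType)
    (lambda : dual R G -> R) (f g : G -> R[i]^o) : R[i] :=
  csum (fun gamma : dual R G =>
    fcoef f gamma * Num.conj (fcoef g gamma) / (lambda gamma)%:C).

Definition harmonic_kernel (R : realType) (G : topologicalZmodType)
    (lambda : dual R G -> R) (x : G) : G -> R[i]^o :=
  fun y => csum (fun gamma : dual R G =>
    (lambda gamma)%:C * Num.conj (gamma x : R[i]) * gamma y).

Definition convolution (R : realType) (G : topologicalZmodType)
    (l m : dual R G -> R) (gamma : dual R G) : \bar R :=
  \esum_(alpha in [set: dual R G]) (l alpha * m (gamma - alpha))%:E.

Definition subconvolutive (R : realType) (G : topologicalZmodType)
    (lambda : dual R G -> R) : Prop :=
  exists C : R, forall gamma : dual R G,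
    (convolution lambda lambda gamma <= (C * lambda gamma)%:E)%E.

(* Main.v *)
(* The spectral side: f |-> (Fourier coefficients of f) is a unitary map from
   the harmonic space onto l^2(1/lambda), under which k_x has the coefficients
   lambda * conj(gamma(x)).  Uniqueness of Fourier coefficients, and every later
   use of orthogonality of characters, comes from finite averages
   gamma |-> (1/n) sum_i gamma(x_i), which can be made small on any given finite
   set of nontrivial characters; no Haar measure is used.

   Strict positive definiteness needs characters that separate points.  They
   are obtained as follows.  Left translates of uniformly continuous functions
   being totally bounded, such functions have an invariant mean.  Put
   psi_u(x) = mean_z u(x + z) conj(u(z)) and, for fixed g, maximize the energy
   mean |g * psi_u|^2 over u with mean |u|^2 = 1.  Along a maximizing sequence,
   g * psi_u is asymptotically equivariant, with multiplier psi_u(a) under the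
   translation by a, and an ultralimit of psi_u is a character c.  For
   g = h - h(. - a0), triviality of c at a0 would make the limit of h * psi_u
   grow linearly along the multiples of a0.

   The tensor square is l^2 of the pairs, and the comultiplication sends f to
   (alpha, beta) |-> lambda(alpha) lambda(beta) / lambda(alpha + beta) times the
   coefficient of f at alpha + beta; its squared norm is governed by
   (lambda * lambda) / lambda.  Conversely, if Delta is bounded, apply it to the
   averages (1/n) sum_i gamma(x_i) k_{x_i}, which approximate lambda(gamma) gamma
   and whose images have inner product 1 with each alpha (x) (gamma - alpha),
   and pair with the sum of lambda(alpha) lambda(gamma - alpha)
   alpha (x) (gamma - alpha) over a finite set of alpha. *)

Require Import Defs.
From mathcomp Require Import all_boot all_order all_algebra complex finmap.
From mathcomp Require Import all_classical all_reals all_analysis.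
From mathcomp Require Import ring lra.

Set Implicit Arguments.
Unset Strict Implicit.
Unset Printing Implicit Defensive.

Import Order.TTheory GRing.Theory Num.Theory.
Import numFieldNormedType.Exports.

Local Open Scope classical_set_scope.
Local Open Scope fset_scope.
Local Open Scope ring_scope.
Local Open Scope complex_scope.

(** * The real-valued modulus of complex numbers *)

Section ComplexModulus.
Variable R : realType.
Implicit Types (x y : R) (z w : R[i]).

Lemma normE z : `|z| = (cabs z)%:C.
Proof. by rewrite /cabs normc_def. Qed.

Lemma cabs_ge0 z : 0 <= cabs z.
Proof. by rewrite -lecR -normE normr_ge0. Qed.

Lemma cabsM z w : cabs (z * w) = cabs z * cabs w.
Proof. by apply: complexI; rewrite rmorphM /= -!normE normrM. Qed.

Lemma cabsD z w : cabs (z + w) <= cabs z + cabs w.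
Proof. by rewrite -lecR rmorphD /= -!normE ler_normD. Qed.

Lemma cabsN z : cabs (- z) = cabs z.
Proof. by apply: complexI; rewrite -!normE normrN. Qed.

Lemma cabsC z w : cabs (z - w) = cabs (w - z).
Proof. by rewrite -cabsN opprB. Qed.

Lemma cabs0 : cabs (0 : R[i]) = 0.
Proof. by apply: complexI; rewrite -normE normr0. Qed.

Lemma cabs1 : cabs (1 : R[i]) = 1.
Proof. by apply: complexI; rewrite -normE normr1. Qed.

Lemma cabs_eq0 z : (cabs z == 0) = (z == 0).
Proof. by rewrite -(normr_eq0 z) normE -(inj_eq (@complexI R)). Qed.

Lemma cabs_real x : cabs x%:C = `|x|.
Proof. by rewrite /cabs normc_def /= expr0n /= addr0 sqrtr_sqr. Qed.

Lemma cabsV z : cabs z^-1 = (cabs z)^-1.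
Proof. by apply: complexI; rewrite fmorphV -!normE normfV. Qed.

Lemma cabs_conj z : cabs (Num.conj z) = cabs z.
Proof. by apply: complexI; rewrite -!normE norm_conjC. Qed.

Lemma cabsX z n : cabs (z ^+ n) = cabs z ^+ n.
Proof. by elim: n => [|n IH]; rewrite ?expr0 ?cabs1// !exprS cabsM IH. Qed.

Lemma sqr_cabs z : (cabs z ^+ 2)%:C = z * Num.conj z.
Proof. by rewrite rmorphXn /= -normE normCK. Qed.

Lemma cabs_sqrE z : cabs z ^+ 2 = complex.Re z ^+ 2 + complex.Im z ^+ 2.
Proof. by rewrite /cabs normc_def sqr_sqrtr // addr_ge0 // sqr_ge0. Qed.

Lemma cabs_sum (T : Type) (s : seq T) (f : T -> R[i]) :
  cabs (\sum_(i <- s) f i) <= \sum_(i <- s) cabs (f i).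
Proof.
elim: s => [|i s IH]; first by rewrite !big_nil cabs0.
by rewrite !big_cons (le_trans (cabsD _ _)) // lerD2l.
Qed.

Lemma Re_le_cabs z : `|complex.Re z| <= cabs z.
Proof. by rewrite -lecR -normE normc_ge_Re. Qed.

Lemma Im_le_cabs z : `|complex.Im z| <= cabs z.
Proof.
by rewrite /cabs normc_def /= -sqrtr_sqr ler_wsqrtr // lerDr sqr_ge0.
Qed.

Lemma cabs_le_ReIm z : cabs z <= `|complex.Re z| + `|complex.Im z|.
Proof.
case: z => a b; rewrite /cabs normc_def /=.
rewrite -[leRHS]ger0_norm ?addr_ge0// -sqrtr_sqr ler_wsqrtr//.
rewrite sqrrD !real_normK ?num_real//; apply: lerD => //.
by rewrite lerDl mulrn_wge0 // mulr_ge0.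
Qed.

Lemma ReD z w : complex.Re (z + w) = complex.Re z + complex.Re w.
Proof. by case: z w => [? ?] [? ?]. Qed.
Lemma ImD z w : complex.Im (z + w) = complex.Im z + complex.Im w.
Proof. by case: z w => [? ?] [? ?]. Qed.
Lemma ReN z : complex.Re (- z) = - complex.Re z.
Proof. by case: z => [? ?]. Qed.
Lemma ImN z : complex.Im (- z) = - complex.Im z.
Proof. by case: z => [? ?]. Qed.

Lemma Re_sum (T : Type) (s : seq T) (f : T -> R[i]) :
  complex.Re (\sum_(i <- s) f i) = \sum_(i <- s) complex.Re (f i).
Proof. by elim: s => [|i s IH]; rewrite ?big_nil// !big_cons ReD IH. Qed.
Lemma Im_sum (T : Type) (s : seq T) (f : T -> R[i]) :
  complex.Im (\sum_(i <- s) f i) = \sum_(i <- s) complex.Im (f i).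
Proof. by elim: s => [|i s IH]; rewrite ?big_nil// !big_cons ImD IH. Qed.

Lemma complex_ge0 z : 0 <= z -> z = (complex.Re z)%:C.
Proof. by case: z => a b; rewrite lecE /= => /andP[/eqP -> _]. Qed.

Lemma rcD x y : (x + y)%:C = x%:C + y%:C :> R[i].
Proof. exact: rmorphD. Qed.
Lemma rcB x y : (x - y)%:C = x%:C - y%:C :> R[i].
Proof. exact: rmorphB. Qed.
Lemma rcM x y : (x * y)%:C = x%:C * y%:C :> R[i].
Proof. exact: rmorphM. Qed.
Lemma rcV x : (x^-1)%:C = x%:C^-1 :> R[i].
Proof. exact: fmorphV. Qed.
Lemma rc_nat n : (n%:R : R)%:C = n%:R :> R[i].
Proof. exact: rmorph_nat. Qed.
Lemma rc1 : (1 : R)%:C = 1 :> R[i].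
Proof. exact: rmorph1. Qed.
Lemma rc_eq0 x : (x%:C == 0 :> R[i]) = (x == 0).
Proof. by rewrite -(inj_eq (@complexI R)). Qed.
Lemma conjM z w : Num.conj (z * w) = Num.conj z * Num.conj w.
Proof. exact: rmorphM. Qed.
Lemma conjD z w : Num.conj (z + w) = Num.conj z + Num.conj w.
Proof. exact: rmorphD. Qed.
Lemma conjN z : Num.conj (- z) = - Num.conj z.
Proof. exact: rmorphN. Qed.
Lemma conjV z : Num.conj z^-1 = (Num.conj z)^-1.
Proof. exact: fmorphV. Qed.
Lemma conj_real x : Num.conj (x%:C : R[i]) = x%:C.
Proof. by rewrite conj_Creal // complex_real. Qed.

End ComplexModulus.

(** * Unconditional sums *)

Section UnconditionalSums.
Variable R : realType.

(** Convergence along the directed set of finite subsets. It is linear and compatible with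
    conjugation, so values of [csum] are computed through it rather than through positive and
    negative parts. *)
Definition has_sum (I : choiceType) (f : I -> R[i]) (s : R[i]) :=
  forall e : R, 0 < e -> exists A : {fset I}, forall B : {fset I},
    A `<=` B -> cabs (\sum_(i <- B) f i - s) < e.

Definition bounded_sums (I : choiceType) (g : I -> R) :=
  exists M : R, forall A : {fset I}, \sum_(i <- A) g i <= M.

Definition abs_summable (I : choiceType) (f : I -> R[i]) :=
  bounded_sums (fun i => cabs (f i)).

Variable I : choiceType.
Implicit Types (f g : I -> R[i]) (A B : {fset I}) (p q : I -> R).

Lemma fsum_split (V : nmodType) (f : I -> V) A B : A `<=` B ->
  \sum_(i <- B) f i = \sum_(i <- A) f i + \sum_(i <- B `\` A) f i.
Proof.
move=> AB; rewrite (big_fsetID _ (mem A)) /=; congr (_ + _).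
  apply: eq_fbigl => x; rewrite !inE /=; apply/andP/idP => [[]//|xA].
  by split=> //; exact: (fsubsetP AB).
by apply: eq_fbigl => x; rewrite !inE /= andbC.
Qed.

Lemma fsum_le p A B : (forall i, 0 <= p i) -> A `<=` B ->
  \sum_(i <- A) p i <= \sum_(i <- B) p i.
Proof. by move=> p0 AB; rewrite (fsum_split p AB) lerDl sumr_ge0. Qed.

Lemma fsum_single_le (i0 : I) (c : R) A : 0 <= c -> \sum_(i <- A) (i == i0)%:R * c <= c.
Proof.
move=> c0; case: (boolP (i0 \in A)) => iA.
  rewrite (big_fsetD1 i0) //= eqxx mul1r big_seq big1 ?addr0 // => i.
  by rewrite !inE => /andP[/negbTE ->]; rewrite mul0r.
rewrite big_seq big1 // => i iA'.
have -> : (i == i0) = false by apply: contraNF iA => /eqP <-.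
by rewrite mul0r.
Qed.

Lemma esum_ge_fsum p A : (forall i, 0 <= p i) ->
  ((\sum_(i <- A) p i)%:E <= \esum_(i in [set: I]) (p i)%:E)%E.
Proof.
move=> p0; apply: esum_ge; exists [set` A]; first by split.
by rewrite fsbig_finite //= set_fsetK sumEFin.
Qed.

Lemma esum_le_bound p (M : R) : (forall A, \sum_(i <- A) p i <= M) ->
  (\esum_(i in [set: I]) (p i)%:E <= M%:E)%E.
Proof.
move=> h; apply: ge_ereal_sup => _ [X [fX _] <-].
by rewrite fsbig_finite //= sumEFin lee_fin.
Qed.

Lemma esum_ltyP p : (forall i, 0 <= p i) ->
  (\esum_(i in [set: I]) (p i)%:E < +oo)%E <-> bounded_sums p.
Proof.
move=> p0; split=> [fin|[M hM]]; last first.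
  by apply: le_lt_trans (ltry M); exact: esum_le_bound.
have fn : (\esum_(i in [set: I]) (p i)%:E \is a fin_num)%E.
  by rewrite ge0_fin_numE // esum_ge0// => i _; rewrite lee_fin.
exists (fine (\esum_(i in [set: I]) (p i)%:E)%E) => A.
by rewrite -lee_fin fineK // esum_ge_fsum.
Qed.

Lemma in_L1P f : in_L1 f <-> abs_summable f.
Proof. by apply: esum_ltyP => i; exact: cabs_ge0. Qed.

Lemma bounded_sums_le p q : (forall i, p i <= q i) -> bounded_sums q ->
  bounded_sums p.
Proof. by move=> pq [M h]; exists M => A; apply: le_trans (h A); exact: ler_sum. Qed.

Lemma bounded_sumsD p q : bounded_sums p -> bounded_sums q ->
  bounded_sums (fun i => p i + q i).
Proof.
by move=> [M h] [N k]; exists (M + N) => A; rewrite big_split lerD.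
Qed.

Lemma bounded_sumsZ (c : R) p : 0 <= c -> bounded_sums p ->
  bounded_sums (fun i => c * p i).
Proof.
by move=> c0 [M h]; exists (c * M) => A; rewrite -mulr_sumr ler_wpM2l.
Qed.

(** A finite set whose partial sum is within [e] of the supremum works, since larger sets only add
    non-negative terms. *)
Lemma esum_near p : (forall i, 0 <= p i) -> bounded_sums p ->
  forall e : R, 0 < e -> exists A, forall B, A `<=` B ->
  `|\sum_(i <- B) p i - fine (\esum_(i in [set: I]) (p i)%:E)%E| < e.
Proof.
move=> p0 /(esum_ltyP p0) fin e e0.
have fn : (\esum_(i in [set: I]) (p i)%:E \is a fin_num)%E.
  by rewrite ge0_fin_numE // esum_ge0// => i _; rewrite lee_fin.
have [_ [X [fX _] <-] hX] := ub_ereal_sup_adherent e0 fn.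
rewrite fsbig_finite //= sumEFin in hX.
exists (fset_set X) => B XB.
rewrite ler0_norm; last by rewrite subr_le0 -lee_fin fineK// esum_ge_fsum.
rewrite opprB ltrBlDl -ltrBlDr.
apply: lt_le_trans (fsum_le p0 XB).
by rewrite -lte_fin EFinB fineK.
Qed.

Lemma rsum_near p : bounded_sums (fun i => `|p i|) ->
  forall e : R, 0 < e -> exists A, forall B, A `<=` B ->
  `|\sum_(i <- B) p i - rsum p| < e.
Proof.
move=> sp e e0; rewrite /rsum.
under eq_esum do rewrite funeposE -EFin_max.
under [X in _ - fine X]eq_esum do rewrite funenegE -EFinN -EFin_max.
have pp i : 0 <= Num.max (p i) 0 by rewrite le_max lexx orbT.
have pn i : 0 <= Num.max (- p i) 0 by rewrite le_max lexx orbT.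
have sP : bounded_sums (fun i => Num.max (p i) 0).
  by apply: bounded_sums_le sp => i; rewrite ge_max ler_norm normr_ge0.
have sN : bounded_sums (fun i => Num.max (- p i) 0).
  by apply: bounded_sums_le sp => i; rewrite ge_max -normrN ler_norm normr_ge0.
have e2 : 0 < e / 2 by lra.
have [A hA] := esum_near pp sP e2; have [B hB] := esum_near pn sN e2.
exists (A `|` B) => C; rewrite fsubUset => /andP[/hA {}hA /hB {}hB].
have -> : \sum_(i <- C) p i =
    \sum_(i <- C) Num.max (p i) 0 - \sum_(i <- C) Num.max (- p i) 0.
  rewrite -sumrB; apply: eq_bigr => i _.
  by case: (leP 0 (p i)) => h; [rewrite max_r|rewrite max_l]; lra.
set a := \sum_(i <- C) _ in hA *; set b := \sum_(i <- C) _ in hB *.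
move: hA hB; rewrite !ltr_distl => /andP[? ?] /andP[? ?]; apply/andP; lra.
Qed.

Lemma csumP f : abs_summable f -> has_sum f (csum f).
Proof.
move=> sf e e0; have e2 : 0 < e / 2 by lra.
have sr : bounded_sums (fun i => `|complex.Re (f i)|).
  by apply: bounded_sums_le sf => i; exact: Re_le_cabs.
have si : bounded_sums (fun i => `|complex.Im (f i)|).
  by apply: bounded_sums_le sf => i; exact: Im_le_cabs.
have [A hA] := rsum_near sr e2; have [B hB] := rsum_near si e2.
exists (A `|` B) => C; rewrite fsubUset => /andP[/hA {}hA /hB {}hB].
apply: le_lt_trans (cabs_le_ReIm _) _.
rewrite ReD ImD ReN ImN Re_sum Im_sum /=; lra.
Qed.

Lemma eq_has_sum f g s : f =1 g -> has_sum f s -> has_sum g s.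
Proof. by move=> /funext ->. Qed.

Lemma has_sum_unique f s t : has_sum f s -> has_sum f t -> s = t.
Proof.
move=> hs ht; apply/eqP; rewrite -subr_eq0 -cabs_eq0 eq_le cabs_ge0 andbT.
apply/ler_addgt0Pl => e e0; rewrite addr0.
have e2 : 0 < e / 2 by lra.
have [A hA] := hs _ e2; have [B hB] := ht _ e2.
have := hA (A `|` B) (fsubsetUl _ _); have := hB (A `|` B) (fsubsetUr _ _).
set c := \sum_(i <- _) _ => h1 h2.
have := cabsD (s - c) (c - t); rewrite subrKA (cabsC s); lra.
Qed.

Lemma csum_eq f s : abs_summable f -> has_sum f s -> csum f = s.
Proof. by move=> /csumP; exact: has_sum_unique. Qed.

Lemma has_sumD f g s t : has_sum f s -> has_sum g t ->
  has_sum (fun i => f i + g i) (s + t).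
Proof.
move=> hs ht e e0; have e2 : 0 < e / 2 by lra.
have [A hA] := hs _ e2; have [B hB] := ht _ e2.
exists (A `|` B) => C; rewrite fsubUset => /andP[/hA {}hA /hB {}hB].
rewrite big_split /= opprD addrACA.
by apply: le_lt_trans (cabsD _ _) _; lra.
Qed.

Lemma has_sumZ (c : R[i]) f s : has_sum f s -> has_sum (fun i => c * f i) (c * s).
Proof.
move=> hs e e0; have c1 : 0 < cabs c + 1 by have := cabs_ge0 c; lra.
have [A hA] := hs (e / (cabs c + 1)) (divr_gt0 e0 c1).
exists A => B /hA; rewrite -mulr_sumr -mulrBr cabsM ltr_pdivlMr // => h.
apply: le_lt_trans h; rewrite mulrC ler_wpM2l ?cabs_ge0//; lra.
Qed.

Lemma has_sum_conj f s : has_sum f s ->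
  has_sum (fun i => Num.conj (f i)) (Num.conj s).
Proof.
move=> hs e e0; have [A hA] := hs e e0; exists A => B /hA.
by rewrite -rmorph_sum -rmorphB cabs_conj.
Qed.

Lemma has_sum_fset f (A : {fset I}) : (forall i, i \notin A -> f i = 0) ->
  has_sum f (\sum_(i <- A) f i).
Proof.
move=> f0 e e0; exists A => B AB.
rewrite (fsum_split f AB) [X in _ + X - _]big1_seq.
  by rewrite addr0 subrr cabs0.
by move=> i /=; rewrite !inE => /andP[/f0].
Qed.

Lemma has_sum_single f j : (forall i, i != j -> f i = 0) -> has_sum f (f j).
Proof.
move=> h; rewrite -[f j](big_seq_fset1 +%R j f).
by apply: has_sum_fset => i; rewrite inE => /h.
Qed.

Lemma has_sum_cabs_le f s (M : R) :
  (forall A, \sum_(i <- A) cabs (f i) <= M) -> has_sum f s -> cabs s <= M.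
Proof.
move=> h hs; apply/ler_addgt0Pl => e e0.
have [A hA] := hs e e0; have := hA A (fsubset_refl _).
have := cabsD (s - \sum_(i <- A) f i) (\sum_(i <- A) f i).
rewrite subrK cabsC; have := cabs_sum A f; have := h A; lra.
Qed.

Lemma has_sum_real_ge p s : (forall i, 0 <= p i) ->
  has_sum (fun i => (p i)%:C) s ->
  s = (complex.Re s)%:C /\ forall A, \sum_(i <- A) p i <= complex.Re s.
Proof.
move=> p0 hs; split.
  apply/eqP; rewrite eq_complex /= eqxx /= -normr_eq0 eq_le normr_ge0 andbT.
  apply/ler_addgt0Pl => e e0; rewrite addr0.
  have [A hA] := hs e e0; have /ltW := hA A (fsubset_refl _).
  apply: le_trans; apply: le_trans (Im_le_cabs _); rewrite ImD ImN Im_sum /=.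
  by rewrite big1 // sub0r normrN.
move=> A; apply/ler_addgt0Pl => e e0.
have [B hB] := hs e e0; have := hB (A `|` B) (fsubsetUr _ _).
set C := A `|` B; have : \sum_(i <- A) p i <= \sum_(i <- C) p i.
  by apply: fsum_le => //; exact: fsubsetUl.
have := Re_le_cabs (\sum_(i <- C) (p i)%:C - s).
rewrite ReD ReN Re_sum /= => h1 h2 h3.
have := ler_norm (\sum_(i <- C) p i - complex.Re s); lra.
Qed.

Lemma has_sum_real_le p s (M : R) : (forall A, \sum_(i <- A) p i <= M) ->
  has_sum (fun i => (p i)%:C) s -> complex.Re s <= M.
Proof.
move=> hM hs; apply/ler_addgt0Pl => e e0.
have [A hA] := hs e e0; have := hA A (fsubset_refl _).
have := Re_le_cabs (\sum_(i <- A) (p i)%:C - s).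
rewrite ReD ReN Re_sum /= => h1 h2; have := hM A.
have := ler_norm (- (\sum_(i <- A) p i - complex.Re s)); rewrite normrN; lra.
Qed.

(** The partial sums over [A] and over its union with [B] are both within [e / 2] of the total. *)
Lemma bounded_sums_tail p : (forall i, 0 <= p i) -> bounded_sums p ->
  forall e : R, 0 < e -> exists A, forall B, \sum_(i <- B `\` A) p i <= e.
Proof.
move=> p0 sp e e0; have e2 : 0 < e / 2 by lra.
have [A hA] := esum_near p0 sp e2; exists A => B.
have := hA (A `|` B) (fsubsetUl _ _); have := hA A (fsubset_refl _).
rewrite (fsum_split p (fsubsetUl A B)) fsetDUl fsetDv fset0U.
rewrite !ltr_distl => /andP[? ?] /andP[? ?]; lra.
Qed.

End UnconditionalSums.

(** * Hilbert spaces and weighted l^2 *)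

Section HilbertSpaces.
Variables (R : realType) (L : lmodType R[i]) (H : set L) (ip : L -> L -> R[i]).
Hypothesis hH : is_hilbert H ip.
Implicit Types (u v w : L).

Lemma hilbertD u v : H u -> H v -> H (u + v).
Proof. by move=> hu hv; rewrite -[u]scale1r; exact: (hilbert_lin hH). Qed.

Lemma hilbertZ (a : R[i]) u : H u -> H (a *: u).
Proof.
move=> hu; rewrite -[_ *: _]addr0; by apply: (hilbert_lin hH) => //; exact: (hilbert_0 hH).
Qed.

Lemma hilbertB u v : H u -> H v -> H (u - v).
Proof. by move=> hu hv; rewrite -scaleN1r; apply: hilbertD => //; exact: hilbertZ. Qed.

Lemma hilbert_sum (T : Type) (s : seq T) (u : T -> L) :
  (forall i, H (u i)) -> H (\sum_(i <- s) u i).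
Proof.
move=> hu; elim: s => [|i s IH]; first by rewrite big_nil; exact: hilbert_0 hH.
by rewrite big_cons; apply: hilbertD.
Qed.

Lemma ip0l v : H v -> ip 0 v = 0.
Proof.
move=> hv; have h0 := hilbert_0 hH.
have := ip_linear hH 1 h0 h0 hv; rewrite scale1r addr0 mul1r => /eqP.
by rewrite -subr_eq0 opprD addrA subrr sub0r oppr_eq0 => /eqP.
Qed.

Lemma ipDl u v w : H u -> H v -> H w -> ip (u + v) w = ip u w + ip v w.
Proof.
by move=> hu hv hw; rewrite -[in LHS](scale1r u) (ip_linear hH) // mul1r.
Qed.

Lemma ipZl (a : R[i]) u v : H u -> H v -> ip (a *: u) v = a * ip u v.
Proof.
move=> hu hv; rewrite -[in LHS](addr0 (a *: u)) (ip_linear hH) //.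
  by rewrite ip0l // addr0.
exact: hilbert_0 hH.
Qed.

Lemma ipDr u v w : H u -> H v -> H w -> ip w (u + v) = ip w u + ip w v.
Proof.
move=> hu hv hw; have huv := hilbertD hu hv.
by rewrite (ip_conj hH huv hw) ipDl // rmorphD /= -!(ip_conj hH).
Qed.

Lemma ipZr (a : R[i]) u v : H u -> H v -> ip v (a *: u) = Num.conj a * ip v u.
Proof.
move=> hu hv; have hau := hilbertZ a hu.
by rewrite (ip_conj hH hau hv) ipZl // rmorphM /= -(ip_conj hH).
Qed.

Lemma ip_suml (T : Type) (s : seq T) (a : T -> R[i]) (u : T -> L) v :
  (forall i, H (u i)) -> H v ->
  ip (\sum_(i <- s) a i *: u i) v = \sum_(i <- s) a i * ip (u i) v.
Proof.
move=> hu hv; elim: s => [|i s IH]; first by rewrite !big_nil ip0l.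
rewrite !big_cons (ip_linear hH) ?IH //.
by apply: hilbert_sum => j; exact: hilbertZ.
Qed.

Lemma ip_sumr (T : Type) (s : seq T) (a : T -> R[i]) (u : T -> L) v :
  (forall i, H (u i)) -> H v ->
  ip v (\sum_(i <- s) a i *: u i) = \sum_(i <- s) Num.conj (a i) * ip v (u i).
Proof.
move=> hu hv.
have hs : H (\sum_(i <- s) a i *: u i) by apply: hilbert_sum => j; exact: hilbertZ.
rewrite (ip_conj hH hs hv) ip_suml // rmorph_sum; apply: eq_bigr => i _.
by rewrite rmorphM /= -(ip_conj hH).
Qed.

Lemma ip_norm_ge0 u : 0 <= ip_norm ip u.
Proof. exact: sqrtr_ge0. Qed.

Lemma ip_normE u : H u -> ip u u = (ip_norm ip u ^+ 2)%:C.
Proof.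
move=> hu; have h := ip_ge0 hH hu.
by rewrite sqr_sqrtr -?complex_ge0 // -lecR -complex_ge0.
Qed.

Lemma ip_cauchy_schwarz u v : H u -> H v ->
  cabs (ip u v) <= ip_norm ip u * ip_norm ip v.
Proof.
move=> hu hv; set n := ip_norm ip u; set m := ip_norm ip v.
have n0 : 0 <= n by exact: ip_norm_ge0.
have m0 : 0 <= m by exact: ip_norm_ge0.
(* If [m = 0] then [v = 0] by definiteness; otherwise division by [m ^+ 2] is legitimate. *)
have [mz|mnz] := eqVneq m 0.
  have v0 : v = 0.
    by apply: (ip_eq0 hH hv); rewrite ip_normE // -/m mz expr0n.
  have h0 := hilbert_0 hH.
  rewrite v0 (ip_conj hH h0 hu) ip0l // rmorph0 cabs0.
  by rewrite mulr_ge0 // ip_norm_ge0.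
set z := ip u v.
(* The component of [u] orthogonal to [v]; its squared norm is [n ^+ 2 - cabs z ^+ 2 / m ^+ 2]. *)
have hw : H (u - (z / (m ^+ 2)%:C) *: v) by apply: hilbertB => //; exact: hilbertZ.
have := ip_ge0 hH hw.
rewrite -scaleNr; set c := - _.
have hcv : H (c *: v) by exact: hilbertZ.
have huc : H (u + c *: v) by exact: hilbertD.
rewrite ipDl // !ipDr // !ipZl // !ipZr // (ip_conj hH hu hv) !ip_normE // -/n -/m -/z.
have m20 : (m ^+ 2)%:C != 0 :> R[i].
  by rewrite -(rmorph0 (real_complex R)) (inj_eq (@complexI R)) expf_neq0.
have -> : (n ^+ 2)%:C + Num.conj c * z + (c * Num.conj z + c * (Num.conj c * (m ^+ 2)%:C))
   = (n ^+ 2 - cabs z ^+ 2 / m ^+ 2)%:C.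
  have -> : Num.conj c = - (Num.conj z / (m ^+ 2)%:C).
    by rewrite conjN conjM conjV conj_real.
  rewrite rcB rcM sqr_cabs rcV /c.
  by move: (m ^+ 2)%:C m20 => M M0; field.
rewrite -(rmorph0 (real_complex R)) lecR subr_ge0 ler_pdivrMr ?exprn_gt0 ?lt_def ?mnz//.
by rewrite -exprMn ler_pXn2r // nnegrE ?cabs_ge0 ?mulr_ge0.
Qed.

End HilbertSpaces.

Lemma complex_cauchy (R : realType) (z : nat -> R[i]) :
  (forall e : R, 0 < e -> exists N, forall m n, (N <= m)%N -> (N <= n)%N ->
    cabs (z m - z n) < e) ->
  exists l : R[i], forall e : R, 0 < e -> exists N, forall n, (N <= n)%N ->
    cabs (z n - l) < e.
Proof.
move=> hz.
have real_lim (x : nat -> R) : (forall m n, `|x m - x n| <= cabs (z m - z n)) ->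
    exists l : R, forall e : R, 0 < e -> exists N, forall n, (N <= n)%N ->
    `|x n - l| < e.
  move=> hx.
  have cx : cvg (x @ \oo).
    apply/cauchy_cvgP; apply: cauchy_exP => e e0.
    have [N hN] := hz e e0; exists (x N); exists N => // n /= Nn.
    by rewrite /ball /=; apply: le_lt_trans (hx _ _) (hN _ _ _ _).
  exists (lim (x @ \oo)) => e e0.
  move/cvgrPdist_lt : cx => /(_ e e0) [N _ hN]; exists N => n Nn.
  by rewrite distrC; exact: hN.
have [a ha] : exists l : R, forall e : R, 0 < e -> exists N, forall n, (N <= n)%N ->
    `|complex.Re (z n) - l| < e.
  by apply: real_lim => m n; rewrite -ReN -ReD; exact: Re_le_cabs.
have [b hb] : exists l : R, forall e : R, 0 < e -> exists N, forall n, (N <= n)%N ->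
    `|complex.Im (z n) - l| < e.
  by apply: real_lim => m n; rewrite -ImN -ImD; exact: Im_le_cabs.
exists (a +i* b) => e e0; have e2 : 0 < e / 2 by lra.
have [M hM] := ha _ e2; have [N hN] := hb _ e2; exists (maxn M N) => n.
rewrite geq_max => /andP[/hM {}hM /hN {}hN].
apply: le_lt_trans (cabs_le_ReIm _) _; rewrite ReD ImD ReN ImN /=; lra.
Qed.

(** * The weighted sequence space l^2(1/w) *)

Section WeightedL2.
Variables (R : realType) (I : choiceType) (w : I -> R).
Hypothesis w_gt0 : forall i, 0 < w i.
Implicit Types (a b c : I -> R[i]^o) (A B : {fset I}).

Definition l2 : set (I -> R[i]^o) :=
  [set a | bounded_sums (fun i => cabs (a i) ^+ 2 / w i)].

Definition l2ip a b : R[i] := csum (fun i => a i * Num.conj (b i) / (w i)%:C).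

Let term_ge0 a i : 0 <= cabs (a i) ^+ 2 / w i.
Proof. by rewrite divr_ge0 ?sqr_ge0 // ltW. Qed.

(** Pointwise, |k a + b|^2 <= 2 |k|^2 |a|^2 + 2 |b|^2. *)
Lemma l2_lin (k : R[i]) a b : l2 a -> l2 b -> l2 (k *: a + b).
Proof.
move=> ha hb.
apply: bounded_sums_le (bounded_sumsD (bounded_sumsZ _ ha)
  (bounded_sumsZ (ler0n _ 2) hb)) => [i|]; last first.
  exact: (mulr_ge0 (ler0n _ 2) (sqr_ge0 (cabs k))).
rewrite !mulrA -mulrDl ler_wpM2r ?invr_ge0 ?(ltW (w_gt0 i))//=.
have h : cabs ((k *: a + b) i) <= cabs k * cabs (a i) + cabs (b i).
  by rewrite -cabsM; exact: cabsD.
have p0 : 0 <= cabs k * cabs (a i) by rewrite mulr_ge0 // cabs_ge0.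
have q0 := cabs_ge0 (b i); have r0 := cabs_ge0 ((k *: a + b) i).
have -> : 2 * cabs k * cabs k * cabs (a i) * cabs (a i) =
    2 * (cabs k * cabs (a i)) ^+ 2 by ring.
set p := _ * _ in h p0 *; set q := cabs (b i) in h q0 *; set r := cabs _ in h r0 *.
have := sqr_ge0 (p - q); nra.
Qed.

Lemma l2_0 : l2 0.
Proof.
by exists 0 => A; rewrite big1 // => i _; rewrite cabs0 expr0n mul0r.
Qed.

Lemma abs_summable_ip a b : l2 a -> l2 b ->
  abs_summable (fun i => a i * Num.conj (b i) / (w i)%:C).
Proof.
move=> ha hb; apply: bounded_sums_le (bounded_sumsD ha hb) => i.
rewrite !cabsM cabs_conj -mulrDl cabsV cabs_real (ger0_norm (ltW (w_gt0 i))).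
rewrite ler_wpM2r ?invr_ge0 ?(ltW (w_gt0 i))//.
have := sqr_ge0 (cabs (a i) - cabs (b i)); have := cabs_ge0 (a i); have := cabs_ge0 (b i); nra.
Qed.

Lemma has_sum_ip a b : l2 a -> l2 b ->
  has_sum (fun i => a i * Num.conj (b i) / (w i)%:C) (l2ip a b).
Proof. by move=> ha hb; apply/csumP/abs_summable_ip. Qed.

Lemma has_sum_ip_sqr a : l2 a ->
  has_sum (fun i => (cabs (a i) ^+ 2 / w i)%:C) (l2ip a a).
Proof.
move=> ha; apply: eq_has_sum (has_sum_ip ha ha) => i.
by rewrite rmorphM /= sqr_cabs fmorphV.
Qed.

Lemma l2ip_real a : l2 a -> l2ip a a = (complex.Re (l2ip a a))%:C.
Proof. by move=> /has_sum_ip_sqr/(has_sum_real_ge (term_ge0 a))[]. Qed.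

Lemma fsum_le_l2 a A : l2 a ->
  \sum_(i <- A) cabs (a i) ^+ 2 / w i <= complex.Re (l2ip a a).
Proof. by move=> /has_sum_ip_sqr/(has_sum_real_ge (term_ge0 a))[_]. Qed.

Lemma l2ip_Re_ge0 a : l2 a -> 0 <= complex.Re (l2ip a a).
Proof. by move=> /(fsum_le_l2 fset0); rewrite big_seq_fset0. Qed.

Lemma fsum_le_l2_norm a A : l2 a ->
  \sum_(i <- A) cabs (a i) ^+ 2 / w i <= ip_norm l2ip a ^+ 2.
Proof.
by move=> ha; rewrite sqr_sqrtr ?l2ip_Re_ge0 //; exact: fsum_le_l2.
Qed.

Lemma l2_norm_le a (M : R) : 0 <= M ->
  (forall A, \sum_(i <- A) cabs (a i) ^+ 2 / w i <= M ^+ 2) ->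
  l2 a /\ ip_norm l2ip a <= M.
Proof.
move=> M0 h; have ha : l2 a by exists (M ^+ 2).
split => //; rewrite /ip_norm.
rewrite -[leRHS]ger0_norm // -sqrtr_sqr ler_wsqrtr //.
exact: has_sum_real_le (has_sum_ip_sqr ha).
Qed.

(** A single term is bounded by the whole sum. Hence coordinates are continuous, which provides the
    pointwise limit in the completeness proof. *)
Lemma cabs_le_l2_norm a i : l2 a ->
  cabs (a i) <= Num.sqrt (w i) * ip_norm l2ip a.
Proof.
move=> ha; have := fsum_le_l2_norm [fset i] ha; rewrite big_seq_fset1.
rewrite ler_pdivrMr // => h.
rewrite -[leLHS]ger0_norm ?cabs_ge0// -sqrtr_sqr.
apply: le_trans (ler_wsqrtr h) _.
rewrite sqrtrM ?sqr_ge0// sqrtr_sqr ger0_norm ?sqrtr_ge0// mulrC //.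
Qed.

Lemma l2_inner : [/\ forall (k : R[i]) a b c, l2 a -> l2 b -> l2 c ->
    l2ip (k *: a + b) c = k * l2ip a c + l2ip b c,
  forall a b, l2 a -> l2 b -> l2ip b a = Num.conj (l2ip a b),
  forall a, l2 a -> 0 <= l2ip a a
  & forall a, l2 a -> l2ip a a = 0 -> a = 0].
Proof.
split.
- move=> k a b c ha hb hc; apply: csum_eq.
    by apply: abs_summable_ip => //; exact: l2_lin.
  apply: eq_has_sum (has_sumD (has_sumZ k (has_sum_ip ha hc)) (has_sum_ip hb hc)).
  by move=> i /=; rewrite !mulrA -!mulrDl.
- move=> a b ha hb; apply: csum_eq; first exact: abs_summable_ip.
  apply: eq_has_sum (has_sum_conj (has_sum_ip ha hb)) => i.
  by rewrite !conjM conjV conj_real conjCK (mulrC (b i)).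
- by move=> a ha; rewrite l2ip_real // -(rmorph0 (real_complex R)) lecR l2ip_Re_ge0.
- move=> a ha a0; apply/funext => i; apply/eqP; rewrite -cabs_eq0 eq_le cabs_ge0 andbT.
  by apply: le_trans (cabs_le_l2_norm i ha) _; rewrite /ip_norm a0 sqrtr0 mulr0.
Qed.

(** The limit [l] is taken coordinatewise. On a finite set [A], [u n - l] is compared with
    [u n - u m] for an [m] depending on [A]; the resulting bound does not depend on [A], so it
    passes to the norm. *)
Lemma l2_complete (u : nat -> I -> R[i]^o) : (forall n, l2 (u n)) ->
  ip_cauchy l2ip u ->
  exists2 l, l2 l & (fun n => ip_norm l2ip (u n - l)) @ \oo --> (0 : R).
Proof.
move=> hu cu.
have hB m n : l2 (u m - u n).
  by rewrite addrC -scaleN1r; apply: l2_lin.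
have /choice[l hl] i : exists l : R[i], forall e : R, 0 < e -> exists N, forall n,
    (N <= n)%N -> cabs (u n i - l) < e.
  apply: complex_cauchy => e e0.
  have s0 : 0 < Num.sqrt (w i) by rewrite sqrtr_gt0.
  have [N hN] := cu _ (divr_gt0 e0 s0); exists N => m n Nm Nn.
  apply: le_lt_trans (cabs_le_l2_norm i (hB m n)) _.
  by rewrite mulrC -ltr_pdivlMr //; exact: hN.
have close (e : R) : 0 < e -> exists N, forall n, (N <= n)%N ->
    l2 (u n - l) /\ ip_norm l2ip (u n - l) <= e.
  move=> e0; have e2 : 0 < e / 2 by lra.
  have [N hN] := cu _ e2; exists N => n Nn.
  apply: l2_norm_le; first exact: ltW.
  move=> A.
  (* Each of the finitely many terms gets an equal share of [e ^+ 2 / 4]; the [+ 1] keeps the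
     denominator positive when [A] is empty. *)
  have [k Ak] : exists k, forall m, (k <= m)%N -> forall i, i \in A ->
      cabs (u m i - l i) ^+ 2 / w i <= (e ^+ 2 / 4) / (#|` A|%:R + 1).
    pose d i := Num.sqrt (w i * ((e ^+ 2 / 4) / (#|` A|%:R + 1))).
    have t0 i : 0 < w i * ((e ^+ 2 / 4) / (#|` A|%:R + 1)).
      by rewrite mulr_gt0 ?divr_gt0 ?exprn_gt0// ?ltr_wpDl.
    have d0 i : 0 < d i by rewrite sqrtr_gt0.
    have /choice[f hf] i := hl i _ (d0 i).
    exists (\max_(i <- A) f i)%N => m hm i iA.
    rewrite ler_pdivrMr // mulrC -ler_sqrt ?(ltW (t0 i))//.
    rewrite sqrtr_sqr ger0_norm ?cabs_ge0 // ltW // hf //.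
    by apply: leq_trans hm; exact: leq_bigmax_seq.
  pose m := maxn k N.
  have h1 : \sum_(i <- A) cabs ((u n - u m) i) ^+ 2 / w i <= e ^+ 2 / 4.
    apply: le_trans (fsum_le_l2_norm A (hB n m)) _.
    have := hN n m Nn (leq_maxr _ _); have := ip_norm_ge0 l2ip (u n - u m).
    set x := ip_norm _ _ => *; nra.
  have h2 : \sum_(i <- A) cabs (u m i - l i) ^+ 2 / w i <= e ^+ 2 / 4.
    apply: (@le_trans _ _ (\sum_(i <- A) (e ^+ 2 / 4) / (#|` A|%:R + 1))).
      by rewrite !big_seq; apply: ler_sum => i iA; apply: Ak => //; exact: leq_maxl.
    rewrite big_const_seq count_predT iter_addr_0 -[leLHS]mulr_natr mulrAC.
    rewrite ler_pdivrMr ?ltr_wpDl//.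
    by rewrite ler_wpM2l ?divr_ge0 ?sqr_ge0// lerDl.
  have -> : e ^+ 2 = 2 * (e ^+ 2 / 4) + 2 * (e ^+ 2 / 4) by field.
  apply: le_trans (lerD (ler_wpM2l (ler0n _ 2) h1) (ler_wpM2l (ler0n _ 2) h2)).
  rewrite !mulr_sumr -big_split; apply: ler_sum => i _ /=.
  rewrite !mulrA -mulrDl ler_wpM2r ?invr_ge0 ?(ltW (w_gt0 i))//.
  have -> : (u n - l) i = (u n - u m) i + (u m i - l i).
    by rewrite !fctE addrA subrK.
  have := cabsD ((u n - u m) i) (u m i - l i).
  have := cabs_ge0 ((u n - u m) i + (u m i - l i)).
  have := sqr_ge0 (cabs ((u n - u m) i) - cabs (u m i - l i)).
  set p := cabs (_ + _); set q := cabs (_ i); set r := cabs (_ - _) => *; nra.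
exists l.
  have [N /(_ N (leqnn _))[hN _]] := close 1 ltr01.
  have -> : l = (-1) *: (u N - l) + u N by rewrite scaleN1r opprB subrK.
  exact: l2_lin.
apply/cvgrPdist_lt => e e0; have e2 : 0 < e / 2 by lra.
have [N hN] := close _ e2; near=> n.
rewrite sub0r normrN ger0_norm ?ip_norm_ge0//.
have [|_] := hN n; last by lra.
by near: n; exists N.
Unshelve. all: by end_near. Qed.

Lemma l2_hilbert : is_hilbert l2 l2ip.
Proof.
have [h1 h2 h3 h4] := l2_inner; split => //.
- exact: l2_0.
- exact: l2_lin.
- exact: l2_complete.
Qed.

End WeightedL2.

(** * Invariant means *)

Section Averages.
Variables (R : realType) (G : zmodType).
Implicit Types (s t : seq G) (f g : G -> R) (c d : R).

Definition avg s f (y : G) : R := (size s)%:R^-1 * \sum_(x <- s) f (y + x).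

Lemma avg_ub s f c : s != [::] -> (forall y, f y <= c) -> forall y, avg s f y <= c.
Proof.
move=> s0 h y; have n0 : 0 < (size s)%:R :> R by rewrite ltr0n lt0n size_eq0.
rewrite /avg mulrC ler_pdivrMr // mulr_natr.
rewrite -[leRHS]addr0 -iter_addr -(count_predT s) -big_const_seq.
exact: ler_sum.
Qed.

Lemma avgN s f y : avg s (fun x => - f x) y = - avg s f y.
Proof. by rewrite /avg sumrN mulrN. Qed.

Lemma avgD s f g y : avg s (fun x => f x + g x) y = avg s f y + avg s g y.
Proof. by rewrite /avg big_split mulrDr. Qed.

Lemma avgZ s f c y : avg s (fun x => c * f x) y = c * avg s f y.
Proof. by rewrite /avg -mulr_sumr mulrCA. Qed.

Lemma avg_lb s f c : s != [::] -> (forall y, c <= f y) -> forall y, c <= avg s f y.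
Proof.
move=> s0 h y; rewrite -lerN2 -avgN; apply: avg_ub => // z.
by rewrite lerN2.
Qed.

Lemma avg_near s f c d : s != [::] -> (forall y, `|f y - c| <= d) ->
  forall y, `|avg s f y - c| <= d.
Proof.
move=> s0 h y; rewrite ler_distl; apply/andP; split.
  by apply: avg_lb => // z; have := h z; rewrite ler_distl => /andP[].
by apply: avg_ub => // z; have := h z; rewrite ler_distl => /andP[].
Qed.

Lemma avg_comp s t f y :
  avg s (avg t f) y = avg [seq x + z | x <- s, z <- t] f y.
Proof.
rewrite /avg size_allpairs natrM invfM -mulrA; congr (_ * _).
rewrite -mulr_sumr; congr (_ * _).
rewrite big_allpairs_dep /=; apply: eq_bigr => x _; apply: eq_bigr => z _.
by rewrite addrA.
Qed.

Lemma avg_commute s t f y : avg s (avg t f) y = avg t (avg s f) y.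
Proof.
rewrite /avg -mulr_sumr -[in RHS]mulr_sumr mulrCA; congr (_ * (_ * _)).
by rewrite exchange_big; apply: eq_bigr => z _; apply: eq_bigr => x _; rewrite addrAC.
Qed.

Lemma allpairs_neq0 s t : s != [::] -> t != [::] ->
  [seq x + z | x <- s, z <- t] != [::].
Proof. by rewrite -!size_eq0 size_allpairs muln_eq0 negb_or => -> ->. Qed.

(** Von Neumann's mean: a constant uniformly approximated by finite averages of translates.
    Sequences are used instead of sets so that averages compose with multiplicities. *)
Definition has_mean f c := forall e : R, 0 < e -> exists2 s : seq G, s != [::] &
  forall y, `|avg s f y - c| <= e.

(** Averages over [s] and [t] commute, and averaging a function keeps it as close to a constant as
    it was. The composed average therefore serves both functions. *)
Lemma has_mean_lin (k : R) f g c d : has_mean f c -> has_mean g d ->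
  has_mean (fun x => k * f x + g x) (k * c + d).
Proof.
move=> hf hg e e0; have k0 : 0 < `|k| + 1 by rewrite ltr_wpDl.
have e2 : 0 < e / 2 by lra.
have [s s0 hs] := hf _ (divr_gt0 e2 k0); have [t t0 ht] := hg _ e2.
exists [seq x + z | x <- s, z <- t]; first exact: allpairs_neq0.
move=> y; rewrite -avg_comp.
have -> : avg s (avg t (fun x => k * f x + g x)) y =
    k * avg t (avg s f) y + avg s (avg t g) y.
  rewrite avg_commute -avgZ [X in _ + X]avg_commute -avgD.
  congr (avg t _ y); apply/funext => x.
  by rewrite avgD avgZ.
have h1 := avg_near t0 hs y; have h2 := avg_near s0 ht y.
rewrite opprD addrACA -mulrBr (le_trans (ler_normD _ _)) // normrM.
have : `|k| * `|avg t (avg s f) y - c| <= e / 2.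
  rewrite ler_pdivlMr // in h1; rewrite mulrC.
  by apply: le_trans h1; rewrite ler_wpM2l // lerDl.
lra.
Qed.

Lemma has_mean_cst c : has_mean (fun=> c) c.
Proof.
move=> e e0; exists [:: 0] => // y.
by rewrite /avg big_seq1 invr1 mul1r subrr normr0 ltW.
Qed.

(** By linearity the zero function [- f + f] has mean [- c + d], while all its averages vanish. *)
Lemma has_mean_unique f c d : has_mean f c -> has_mean f d -> c = d.
Proof.
move=> hc hd; apply/eqP; rewrite -subr_eq0 -normr_eq0 eq_le normr_ge0 andbT.
apply/ler_addgt0Pl => e e0; rewrite addr0.
have [s s0 hs] := has_mean_lin (-1) hc hd e0.
apply: le_trans (hs 0); rewrite /avg big1 => [|i _]; last by rewrite mulN1r addNr.
by rewrite mulr0 sub0r opprD mulN1r opprK.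
Qed.

Lemma has_mean_shift f c a : has_mean f c -> has_mean (fun x => f (x + a)) c.
Proof.
move=> h e e0; have [s s0 hs] := h e e0; exists s => // y.
have -> : avg s (fun x => f (x + a)) y = avg s f (y + a); last exact: hs.
by rewrite /avg; congr (_ * _); apply: eq_bigr => x _; rewrite addrAC.
Qed.

Lemma has_mean_ge0 f c : (forall x, 0 <= f x) -> has_mean f c -> 0 <= c.
Proof.
move=> f0 h; apply/ler_addgt0Pl => e e0; have [s s0 hs] := h e e0.
have := avg_lb s0 f0 0; have := hs 0; rewrite ler_distl => /andP[]; lra.
Qed.

Definition mean f : R := xget 0 [set c | has_mean f c].

Lemma meanE f c : has_mean f c -> mean f = c.
Proof. by move=> h; apply: (has_mean_unique _ h); exact: (xgetPex 0 (ex_intro [set c | has_mean f c] c h)). Qed.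

End Averages.

(** * Means of uniformly continuous functions on a compact group *)

Section CompactMean.
Variables (R : realType) (G : topologicalZmodType).
Hypothesis G_compact : compact [set: G].
Implicit Types (f g : G -> R[i]) (p q : G -> R).

Definition bounded_fun f := exists M : R, forall x, cabs (f x) <= M.

Definition unif_cont f := forall e : R, 0 < e ->
  \forall v \near (0 : G), forall x, cabs (f (x + v) - f x) < e.

Definition buc f := bounded_fun f /\ unif_cont f.

(** Compactness in its near-covering form, for the filter on finite sequences generated by the sets
    of sequences containing a given one: near [x], every sequence containing [x] has [x] itself as a
    centre. *)
Lemma finite_cover (U : set G) : nbhs 0 U ->
  exists s : seq G, forall x, exists2 y, y \in s & U (x - y).
Proof.
move=> U0; pose F := filter_from [set: seq G] (fun s => [set t : seq G | {subset s <= t}]).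
have FF : Filter F.
  apply: filter_from_filter; first by exists [::].
  move=> s t _ _; exists (s ++ t) => // r /= h; split=> x xs; apply: h;
  by rewrite mem_cat xs ?orbT.
have := (compact_near_coveringP [set: G]).1 G_compact _ F
  (fun s x => exists2 y, y \in s & U (x - y)) FF.
case=> [x _|s _ hs].
  exists ([set x' | U (x' - x)], [set t : seq G | x \in t]); last first.
    by case=> x' t /= [Ux xt]; exists x.
  split; last by exists [:: x] => // t; apply; rewrite mem_head.
  have : (fun x' => x' - x) @ x --> x - x.
    apply: (@continuous_comp G (G * G)%type G (fun x' => (x', x)) (fun z => z.1 - z.2)).
      by apply: cvg_pair; [exact: cvg_id|exact: cvg_cst].
    exact: sub_continuous.
  by rewrite subrr; apply.
by exists s => x; exact: (hs s (fun _ => id) x I).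
Qed.

Lemma nbhs0_shift (x : G) : (fun z : G * G => z.1 + z.2) @ (x, 0 : G) --> x.
Proof. by rewrite -{2}(addr0 x); exact: (@add_continuous G (x, 0)). Qed.

(** The near-covering form of compactness, for the filter of neighbourhoods of 0, makes the joint
    continuity of [h (x + v)] at the points (x, 0) uniform in [x]. *)
Lemma continuous_unif (V : pseudoMetricNormedZmodType R) (h : G -> V) : continuous h ->
  forall e : R, 0 < e -> \forall v \near (0 : G), forall x, `|h (x + v) - h x| < e.
Proof.
move=> ch e e0; have e2 : 0 < e / 2 by lra.
suff cov (x : G) : [set: G] x ->
    \forall x' \near x & v \near nbhs (0 : G), `|h (x' + v) - h x'| < e.
  have H := (compact_near_coveringP [set: G]).1 G_compact _ (nbhs (0 : G))
    (fun v x => `|h (x + v) - h x| < e) (nbhs_filter _) cov.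
  by apply: filterS H => v H x; exact: H.
move=> _.
have h1 : \forall z \near (x, 0 : G), `|h x - h (z.1 + z.2)| < e / 2.
  have : h \o (fun z : G * G => z.1 + z.2) @ (x, 0 : G) --> h x.
    by move=> U /(ch x)/nbhs0_shift.
  by move/cvgrPdist_lt/(_ _ e2).
have h2 : \forall z \near (x, 0 : G), `|h x - h z.1| < e / 2.
  exists ([set y | `|h x - h y| < e / 2], setT); last by case=> y v [].
  split; last exact: filterT.
  by move/cvgrPdist_lt : (ch x) => /(_ _ e2).
apply: filterS2 h1 h2 => z /= a1 a2.
rewrite -(subrKA (h x)) (le_lt_trans (ler_normD _ _)) // distrC; lra.
Qed.

Lemma finite_range_bound (s : seq G) (F : G -> R) : exists M, forall y, y \in s -> F y <= M.
Proof.
exists (\sum_(y <- s) `|F y|) => y ys.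
rewrite (big_rem y) //= (le_trans (ler_norm _)) // lerDl.
by rewrite sumr_ge0.
Qed.

Lemma unif_cont_buc f : unif_cont f -> buc f.
Proof.
move=> uf; split => //; have [s hs] := finite_cover (uf 1 ltr01).
have [M hM] := finite_range_bound s (fun y => cabs (f y)).
exists (M + 1) => x; have [y ys /(_ y)] := hs x; rewrite (addrC y) subrK.
have := hM y ys; have := cabsD (f x - f y) (f y); rewrite subrK; lra.
Qed.

Lemma buc_cst (c : R[i]) : buc (fun=> c).
Proof.
apply: unif_cont_buc => e e0; apply: nearW => v x.
by rewrite subrr cabs0.
Qed.

Lemma bucD f g : buc f -> buc g -> buc (fun x => f x + g x).
Proof.
move=> [_ uf] [_ ug]; apply: unif_cont_buc => e e0; have e2 : 0 < e / 2 by lra.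
apply: filterS2 (uf _ e2) (ug _ e2) => v hf hg x.
have {}hf := hf x; have {}hg := hg x.
by rewrite opprD addrACA; apply: le_lt_trans (cabsD _ _) _; lra.
Qed.

Lemma bucM f g : buc f -> buc g -> buc (fun x => f x * g x).
Proof.
move=> [[M hM] uf] [[N hN] ug]; apply: unif_cont_buc => e e0.
have M0 : 0 <= M := le_trans (cabs_ge0 _) (hM 0).
have N0 : 0 <= N := le_trans (cabs_ge0 _) (hN 0).
have e2 : 0 < e / 2 / (M + N + 1) by rewrite !divr_gt0 //; lra.
apply: filterS2 (uf _ e2) (ug _ e2) => v hf hg x.
have -> : f (x + v) * g (x + v) - f x * g x =
  (f (x + v) - f x) * g (x + v) + f x * (g (x + v) - g x) by ring.
apply: le_lt_trans (cabsD _ _) _; rewrite !cabsM.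
have := hf x; have := hg x; rewrite !ltr_pdivlMr; try lra.
have := hM x; have := hN (x + v).
have := cabs_ge0 (f (x + v) - f x); have := cabs_ge0 (g (x + v) - g x).
set a := cabs (f (x + v) - _); set b := cabs (g _ - _); set k := cabs (f x); set l := cabs (g _).
move=> b0 a0 hl hk h1 h2.
have : a * l <= a * N by rewrite ler_wpM2l.
have : k * b <= M * b by rewrite ler_wpM2r.
nra.
Qed.

Lemma buc_conj f : buc f -> buc (fun x => Num.conj (f x)).
Proof.
move=> [_ uf]; apply: unif_cont_buc => e e0; apply: filterS (uf e e0) => v h x.
by rewrite -rmorphB cabs_conj.
Qed.

Lemma buc_shift f a : buc f -> buc (fun x => f (x + a)).
Proof.
move=> [_ uf]; apply: unif_cont_buc => e e0; apply: filterS (uf e e0) => v h x.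
by rewrite addrAC.
Qed.

Lemma buc_reflect f a : buc f -> buc (fun x => f (a - x)).
Proof.
move=> [_ uf]; apply: unif_cont_buc => e e0.
have : (-%R : G -> G) @ (0 : G) --> (0 : G) by rewrite -{2}oppr0; exact: opp_continuous.
move=> /(_ _ (uf e e0)) /=; rewrite /nbhs /= => h; apply: filterS h => v h x.
by rewrite opprD addrA.
Qed.

Lemma buc_Re f : buc f -> buc (fun x => (complex.Re (f x))%:C).
Proof.
move=> [_ uf]; apply: unif_cont_buc => e e0; apply: filterS (uf e e0) => v h x.
by apply: le_lt_trans (h x); rewrite -rcB cabs_real -ReN -ReD Re_le_cabs.
Qed.

Lemma buc_Im f : buc f -> buc (fun x => (complex.Im (f x))%:C).
Proof.
move=> [_ uf]; apply: unif_cont_buc => e e0; apply: filterS (uf e e0) => v h x.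
by apply: le_lt_trans (h x); rewrite -rcB cabs_real -ImN -ImD Im_le_cabs.
Qed.

Lemma buc_cabs2 f : buc f -> buc (fun x => (cabs (f x) ^+ 2)%:C).
Proof.
move=> bf; have := bucM bf (buc_conj bf); congr buc.
by apply/funext => x; rewrite sqr_cabs.
Qed.

(* Von Neumann's mean ergodic argument: an average of [p] whose supremum is
   almost the smallest possible is almost constant, since otherwise averaging
   it over a finite cover would decrease its supremum further. *)
Lemma has_mean_buc p : buc (fun x => (p x)%:C) -> exists c, has_mean p c.
Proof.
move=> [[B hB] up].
have pB x : `|p x| <= B by rewrite -cabs_real.
pose S := [set M : R | exists2 s : seq G, s != [::] & forall y, avg s p y <= M].
have hS : has_inf S.
  split; first by exists B, [:: 0] => // y; apply: avg_ub => // z; apply: le_trans (pB z); exact: ler_norm.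
  exists (- B) => M [s s0 hs]; apply: le_trans (hs 0); apply: avg_lb => // z.
  by have := pB z; rewrite ler_norml => /andP[].
pose c := inf S.
exists c => e e0; have e3 : 0 < e / 3 by lra.
have [t ht] := finite_cover (up _ e3).
have t0 : t != [::] by case: (ht 0) => y; case: (t).
have n0 : 0 < (size t)%:R :> R by rewrite ltr0n lt0n size_eq0.
have n1 : 1 <= (size t)%:R :> R by rewrite ler1n lt0n size_eq0.
set n : R := (size t)%:R in n0 n1.
(* If [n] values are all below c + e/(3n) and their average is above c - e/(3n), then each of them
   exceeds c - 2e/3. *)
have d0 : 0 < e / 3 / n by rewrite divr_gt0.
have [M [s s0 hs] Mc] := inf_adherent d0 hS; rewrite -/c in Mc.
exists s => // y; set h := avg s p in hs *.
have hh x v : (forall x, cabs ((p (x + v))%:C - (p x)%:C) < e / 3) -> `|h (x + v) - h x| <= e / 3.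
  move=> hv.
  have -> : h (x + v) - h x = avg s (fun x => p (x + v) - p x) x - 0.
    rewrite subr0 avgD avgN; congr (_ - _).
    by rewrite /h /avg; congr (_ * _); apply: eq_bigr => z _; rewrite addrAC.
  by apply: avg_near => // z; rewrite subr0 -cabs_real rcB ltW.
(* Otherwise averaging [h] over [t] would bring the supremum down to c - e/(3n), below the infimum
   [c]. *)
have [x hx] : exists x, c - e / 3 / n < avg t h x.
  apply: contrapT => /forallNP hn.
  have : S (c - e / 3 / n).
    exists [seq x + z | x <- t, z <- s]; first exact: allpairs_neq0.
    by move=> z; rewrite -avg_comp leNgt; apply/negP; exact: hn.
  by move/(ge_inf hS.2); rewrite -/c; lra.
have hM z : h z < c + e / 3 / n by apply: le_lt_trans (hs z) _.
have hlow z : z \in t -> c - 2 * (e / 3) < h (x + z).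
  move=> zt; move: hx.
  have -> : avg t h x = n^-1 * \sum_(y <- t) h (x + y) by [].
  rewrite [X in _ < X -> _]mulrC ltr_pdivlMr // (big_rem z) //= -/n.
  have : \sum_(y0 <- rem z t) h (x + y0) <= (n - 1) * (c + e / 3 / n).
    have -> : n - 1 = (size (rem z t))%:R.
      by rewrite size_rem // -subn1 natrB // lt0n size_eq0.
    rewrite mulr_natl -[leRHS]addr0 -iter_addr -(count_predT (rem z t)) -big_const_seq.
    by apply: ler_sum => i _; exact: ltW.
  have : n * (e / 3 / n) = e / 3 by rewrite mulrC divfK // gt_eqF.
  have := divr_gt0 e3 n0; set d := e / 3 / n; nra.
rewrite ler_distl; apply/andP; split; last first.
  apply: le_trans (ltW (hM y)) _; rewrite lerD2l ler_pdivrMr //; nra.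
(* By the cover, [y] is a translate of some [x + z] by an element of the neighbourhood, so [h y]
   inherits the lower bound up to [e / 3]. *)
have [z zt /hh hz] := ht (y - x).
have := hz (x + z); have := hlow z zt.
rewrite (_ : x + z + (y - x - z) = y); last first.
  by rewrite -[y - x - z]addrA -opprD (addrC (x + z)) subrK.
by rewrite ler_distl => ? /andP[]; lra.
Qed.

Definition bucR p := buc (fun x => (p x)%:C).

Lemma bucR_mean p : bucR p -> has_mean p (mean p).
Proof. by move=> /has_mean_buc[c hc]; rewrite (meanE hc). Qed.

Lemma bucR_lin (k : R) p q : bucR p -> bucR q -> bucR (fun x => k * p x + q x).
Proof.
move=> bp bq; have := bucD (bucM (buc_cst k%:C) bp) bq; congr buc.
by apply/funext => x; rewrite rcD rcM.
Qed.

Lemma mean_lin (k : R) p q : bucR p -> bucR q ->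
  mean (fun x => k * p x + q x) = k * mean p + mean q.
Proof. by move=> /bucR_mean hp /bucR_mean hq; exact: meanE (has_mean_lin _ hp hq). Qed.

Lemma mean_cst (c : R) : mean ((fun=> c) : G -> R) = c.
Proof. by apply: meanE; exact: (@has_mean_cst R G). Qed.

Lemma meanZ (k : R) p : bucR p -> mean (fun x => k * p x) = k * mean p.
Proof.
move=> bp; rewrite -[RHS]addr0 -[X in _ = _ + X](mean_cst 0) -mean_lin //; last exact: buc_cst.
by congr mean; apply/funext => x; rewrite addr0.
Qed.

Lemma meanD p q : bucR p -> bucR q -> mean (fun x => p x + q x) = mean p + mean q.
Proof.
move=> bp bq; rewrite -[mean p]mul1r -mean_lin //.
by congr mean; apply/funext => x; rewrite mul1r.
Qed.

Lemma mean_ge0 p : bucR p -> (forall x, 0 <= p x) -> 0 <= mean p.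
Proof. by move=> /bucR_mean hp p0; exact: has_mean_ge0 hp. Qed.

Lemma mean_le p q : bucR p -> bucR q -> (forall x, p x <= q x) -> mean p <= mean q.
Proof.
move=> bp bq h; rewrite -subr_ge0 addrC -mulN1r -mean_lin //.
apply: mean_ge0 => [|x]; first exact: bucR_lin.
by rewrite mulN1r addrC subr_ge0.
Qed.

Lemma mean_shift p a : bucR p -> mean (fun x => p (x + a)) = mean p.
Proof. by move=> /bucR_mean hp; exact: (meanE (@has_mean_shift _ _ _ _ a hp)). Qed.

(* A quantitative form of the faithfulness of the mean: the constant [size s]
   depends on [U] only. *)
Lemma mean_lower (U : set G) (s : seq G) p (k : R) x0 : bucR p ->
  (forall x, exists2 y, y \in s & U (x - y)) ->
  (forall x, 0 <= p x) -> (forall v, U v -> k <= p (x0 + v)) ->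
  k / (size s)%:R <= mean p.
Proof.
move=> /bucR_mean hp hs p0 hU; apply/ler_addgt0Pl => e e0.
have [t t0 ht] := hp e e0.
have s0 : s != [::] by case: (hs 0) => y; case: (s).
(* Among the translates of any [x] by the [x0 - y] with [y] in [s], one lies in x0 + U, where [p] is
   at least [k]. So the average of [p] over [s'] is everywhere at least k / size s. *)
pose s' := [seq x0 - y | y <- s].
have s'0 : s' != [::] by rewrite -size_eq0 size_map size_eq0.
have := avg_near s'0 ht 0; rewrite avg_commute ler_distl => /andP[_ h].
have : k / (size s)%:R <= avg t (avg s' p) 0.
  apply: avg_lb => // x; rewrite /avg size_map mulrC ler_wpM2l ?invr_ge0//.
  rewrite big_map; have [y ys Uxy] := hs x; rewrite (big_rem y) //=.
  have := hU _ Uxy; rewrite [x0 + (x - y)]addrCA => h1.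
  by apply: le_trans h1 _; rewrite lerDl sumr_ge0.
by move=> h1; rewrite addrC; exact: le_trans h1 h.
Qed.

Lemma mean_gt0 p x0 : bucR p -> (forall x, 0 <= p x) -> 0 < p x0 -> 0 < mean p.
Proof.
move=> bp p0 px0; have e0 : 0 < p x0 / 2 by lra.
pose U := [set v : G | forall x, cabs ((p (x + v))%:C - (p x)%:C) < p x0 / 2].
have [s hs] := finite_cover (bp.2 _ e0 : nbhs 0 U).
have s0 : (0 < size s)%N by case: (hs 0) => y; case: (s).
have : p x0 / 2 / (size s)%:R <= mean p.
  apply: (mean_lower bp hs p0) => v /(_ x0); rewrite -rcB cabs_real.
  rewrite ltr_distl => /andP[h1 _]; lra.
by apply: lt_le_trans; rewrite divr_gt0 // ltr0n.
Qed.

(** * Complex means and the energy, which stands for the squared L^2 norm *)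

Definition cmean f : R[i] := mean (fun x => complex.Re (f x)) +i* mean (fun x => complex.Im (f x)).

Lemma cmean_lin (k : R[i]) f g : buc f -> buc g ->
  cmean (fun x => k * f x + g x) = k * cmean f + cmean g.
Proof.
move=> bf bg; have [rf jf] := (buc_Re bf, buc_Im bf).
have [rg jg] := (buc_Re bg, buc_Im bg).
have rk := bucR_lin (- complex.Im k) jf rg; have ik := bucR_lin (complex.Im k) rf jg.
case: k rk ik => a b /= rk ik; apply/eqP; rewrite eq_complex /=; apply/andP; split; apply/eqP.
  transitivity (a * mean (fun x => complex.Re (f x)) +
      mean (fun x => - b * complex.Im (f x) + complex.Re (g x))).
    rewrite -mean_lin //; congr mean; apply/funext => x.
    by case: (f x) (g x) => [? ?] [? ?] /=; ring.
  by rewrite mean_lin //; ring.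
transitivity (a * mean (fun x => complex.Im (f x)) +
    mean (fun x => b * complex.Re (f x) + complex.Im (g x))).
  rewrite -mean_lin //; congr mean; apply/funext => x.
  by case: (f x) (g x) => [? ?] [? ?] /=; ring.
by rewrite mean_lin //; ring.
Qed.

Lemma cmean0 : cmean (fun=> 0) = 0.
Proof. by rewrite /cmean /= mean_cst. Qed.

Lemma cmeanZ (k : R[i]) f : buc f -> cmean (fun x => k * f x) = k * cmean f.
Proof.
move=> bf; rewrite -[RHS]addr0 -cmean0 -cmean_lin //; last exact: buc_cst.
by congr cmean; apply/funext => x; rewrite addr0.
Qed.

Lemma cmeanD f g : buc f -> buc g -> cmean (fun x => f x + g x) = cmean f + cmean g.
Proof.
move=> bf bg; rewrite -[cmean f]mul1r -cmean_lin //.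
by congr cmean; apply/funext => x; rewrite mul1r.
Qed.

Lemma cmean_shift f a : buc f -> cmean (fun x => f (x + a)) = cmean f.
Proof.
move=> bf; congr (_ +i* _).
  exact: (@mean_shift (fun x => complex.Re (f x)) a (buc_Re bf)).
exact: (@mean_shift (fun x => complex.Im (f x)) a (buc_Im bf)).
Qed.

Lemma cmean_real p : cmean (fun x => (p x)%:C) = (mean p)%:C.
Proof. by rewrite /cmean /= mean_cst. Qed.

Lemma cmean_le f q : buc f -> bucR q -> (forall x, cabs (f x) <= q x) ->
  cabs (cmean f) <= mean q.
Proof.
move=> bf bq h; set z := cmean f.
have [->|z0] := eqVneq z 0.
  by rewrite cabs0; apply: mean_ge0 => // x; apply: le_trans (h x); exact: cabs_ge0.
have c0 : cabs z != 0 by rewrite cabs_eq0.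
(* Rotating [f] by the phase of its mean makes the modulus of the mean a real part, to which
   monotonicity of the real mean applies. *)
pose w := Num.conj z / (cabs z)%:C.
have cw : cabs w = 1.
  by rewrite cabsM cabs_conj cabsV cabs_real ger0_norm ?cabs_ge0 // divff.
have -> : cabs z = complex.Re (cmean (fun x => w * f x)).
  rewrite cmeanZ // -/z /w mulrAC [_ * z]mulrC -sqr_cabs -rcV -rcM /=.
  by rewrite expr2 mulfK.
apply: mean_le => [||x] //; first by apply: buc_Re; exact: bucM (buc_cst w) bf.
apply: le_trans (h x); rewrite -[leRHS]mul1r -cw -cabsM.
by apply: le_trans (Re_le_cabs _); exact: ler_norm.
Qed.

Lemma cmean_le_cst f (M : R) : buc f -> (forall x, cabs (f x) <= M) ->
  cabs (cmean f) <= M.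
Proof.
move=> bf h; rewrite -(mean_cst M); apply: cmean_le => //; exact: buc_cst.
Qed.

Definition energy f : R := mean (fun x => cabs (f x) ^+ 2).

Lemma energy_ge0 f : buc f -> 0 <= energy f.
Proof. by move=> bf; apply: mean_ge0 => [|x]; [exact: buc_cabs2|exact: sqr_ge0]. Qed.

Lemma energyZ (k : R[i]) f : buc f -> energy (fun x => k * f x) = cabs k ^+ 2 * energy f.
Proof.
move=> bf; rewrite /energy -meanZ; last exact: buc_cabs2.
by congr mean; apply/funext => x; rewrite cabsM exprMn.
Qed.

Lemma energyD_le f g : buc f -> buc g ->
  energy (fun x => f x + g x) <= 2 * energy f + 2 * energy g.
Proof.
move=> bf bg; have b2f := buc_cabs2 bf; have b2g := buc_cabs2 bg.
have b2g' : bucR (fun x => 2 * cabs (g x) ^+ 2).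
  have := bucR_lin 2 b2g (buc_cst 0); congr buc; apply/funext => x.
  by rewrite addr0.
rewrite /energy -(meanZ 2 b2g) -mean_lin //; apply: mean_le.
- exact/buc_cabs2/bucD.
- exact: bucR_lin.
move=> x; have := cabsD (f x) (g x); have := cabs_ge0 (f x + g x).
have := sqr_ge0 (cabs (f x) - cabs (g x)).
set a := cabs (f x + g x); nra.
Qed.

Lemma energy_le f (M : R) : buc f -> (forall x, cabs (f x) <= M) -> energy f <= M ^+ 2.
Proof.
move=> bf h; rewrite -(mean_cst (M ^+ 2)); apply: mean_le.
- exact: buc_cabs2.
- exact: buc_cst.
move=> x; rewrite ler_pXn2r // nnegrE ?cabs_ge0 //.
exact: le_trans (cabs_ge0 _) (h x).
Qed.

(** As p + q = 1, the left side is |q a - p b|^2. For nonzero p and q, the right side is p q times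
    the gap in the convexity inequality for |.|^2 at a/p and b/q with weights p and q. *)
Lemma cabs2_convex (a b : R[i]) (p q : R) : p + q = 1 ->
  cabs (a - (p)%:C * (a + b)) ^+ 2 =
  q * cabs a ^+ 2 + p * cabs b ^+ 2 + (- (p * q)) * cabs (a + b) ^+ 2.
Proof.
move=> pq; have -> : q = 1 - p by lra.
by rewrite !cabs_sqrE; case: a b => [? ?] [? ?] /=; ring.
Qed.

Lemma energy_convex f g (p q : R) : buc f -> buc g -> p + q = 1 ->
  energy (fun x => f x - p%:C * (f x + g x)) =
  q * energy f + p * energy g - p * q * energy (fun x => f x + g x).
Proof.
move=> bf bg pq; have b2f := buc_cabs2 bf; have b2g := buc_cabs2 bg.
have b2h := buc_cabs2 (bucD bf bg).
have bZ (k : R) r : bucR r -> bucR (fun x => k * r x).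
  move=> br; have := bucR_lin k br (buc_cst 0); congr buc; apply/funext => x.
  by rewrite addr0.
rewrite /energy -mulNr -(meanZ _ b2h) -(meanZ _ b2g) -mean_lin //; last exact: bZ.
rewrite -meanD; [|by apply: bucR_lin => //; exact: bZ|exact: bZ].
by congr mean; apply/funext => x; exact: cabs2_convex.
Qed.

End CompactMean.

(** * Characters of a compact group *)

Section Separation.
Variables (R : realType) (G : topologicalZmodType).
Hypothesis G_compact : compact [set: G].
Implicit Types (f g u : G -> R[i]).

Let bD := @bucD R G G_compact.
Let bM := @bucM R G G_compact.
Let bC := @buc_cst R G G_compact.
Let bJ := @buc_conj R G G_compact.
Let bS := fun f a (h : buc f) => buc_shift G_compact a h.

(** The positive definite function attached to [u]. It is bounded by its value [energy u] at 0, so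
    for energy 1 its ultralimits exist; these are the candidate characters. *)
Definition autocor u (x : G) : R[i] := cmean (fun z => u (x + z) * Num.conj (u z)).

Lemma buc_shiftl f a : buc f -> buc (fun x => f (a + x)).
Proof. by move=> /(bS a); congr buc; apply/funext => x; rewrite addrC. Qed.

Lemma buc_autocor_term u x : buc u -> buc (fun z => u (x + z) * Num.conj (u z)).
Proof. by move=> bu; apply: bM; [exact: buc_shiftl|exact: bJ]. Qed.

Lemma cmean_conj f : buc f -> cmean (fun x => Num.conj (f x)) = Num.conj (cmean f).
Proof.
move=> bf; apply/eqP; rewrite eq_complex /=; apply/andP; split; apply/eqP.
  by congr mean; apply/funext => x; case: (f x).
rewrite -mulN1r -meanZ //; last exact: buc_Im.
by congr mean; apply/funext => x; rewrite mulN1r; case: (f x).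
Qed.

Lemma autocorN u a : buc u -> autocor u (- a) = Num.conj (autocor u a).
Proof.
move=> bu; rewrite /autocor -(cmean_shift G_compact a (buc_autocor_term (- a) bu)).
rewrite -cmean_conj; last exact: buc_autocor_term.
by congr cmean; apply/funext => z; rewrite addrCA addNr addr0 conjM conjCK mulrC addrC.
Qed.

Lemma autocor0 u : autocor u 0 = (energy u)%:C.
Proof.
rewrite /autocor /energy -cmean_real //; congr cmean; apply/funext => z.
by rewrite add0r sqr_cabs.
Qed.

Lemma energy_shift u a : buc u -> energy (fun z => u (z + a)) = energy u.
Proof. by move=> bu; exact: (mean_shift G_compact a (buc_cabs2 G_compact bu)). Qed.

Lemma autocor_bound u x : buc u -> cabs (autocor u x) <= energy u.
Proof.
move=> bu; have b2 := buc_cabs2 G_compact bu.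
have b2x := buc_cabs2 G_compact (bS x bu).
have bh : bucR (fun z => 2^-1 * cabs (u z) ^+ 2).
  have := bucR_lin G_compact 2^-1 b2 (bC 0); congr buc; apply/funext => z.
  by rewrite addr0.
have -> : energy u = mean (fun z => 2^-1 * cabs (u (z + x)) ^+ 2 + 2^-1 * cabs (u z) ^+ 2).
  rewrite mean_lin // meanZ // -!/(energy _) energy_shift // -mulrDl; lra.
apply: cmean_le => //; first exact: buc_autocor_term.
  exact: bucR_lin.
move=> z; rewrite cabsM cabs_conj (addrC x).
have := sqr_ge0 (cabs (u (z + x)) - cabs (u z)); nra.
Qed.

Lemma buc_autocor u : buc u -> buc (autocor u).
Proof.
move=> bu; have [[M hM] uu] := bu; apply: unif_cont_buc => // e e0.
have M0 : 0 <= M := le_trans (cabs_ge0 _) (hM 0).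
have d0 : 0 < e / (M + 1) by rewrite divr_gt0 //; lra.
apply: filterS (uu _ d0) => v hv x.
have -> : autocor u (x + v) - autocor u x =
    cmean (fun z => (u (x + z + v) - u (x + z)) * Num.conj (u z)).
  rewrite addrC -mulN1r -cmean_lin //; [|exact: buc_autocor_term..].
  congr cmean; apply/funext => z; rewrite addrAC; ring.
apply: le_lt_trans (cmean_le_cst G_compact (M := e / (M + 1) * M) _ _) _.
- apply: bM; last exact: bJ.
  have := bD (bS v (buc_shiftl x bu)) (bM (bC (-1)) (buc_shiftl x bu)).
  congr buc; apply/funext => z; rewrite addrA; ring.
- move=> z; rewrite cabsM cabs_conj; apply: ler_pM; rewrite ?cabs_ge0 // ltW //.
have : e / (M + 1) * (M + 1) = e by rewrite divfK // gt_eqF //; lra.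
move: d0; set d := e / _; nra.
Qed.

Lemma autocorZ (t : R) u x : buc u ->
  autocor (fun z => t%:C * u z) x = (t ^+ 2)%:C * autocor u x.
Proof.
move=> bu; rewrite /autocor -cmeanZ //; last exact: buc_autocor_term.
by congr cmean; apply/funext => z; rewrite conjM conj_real rcM; ring.
Qed.

(** Of the four terms in the product, the two diagonal ones agree by invariance of the mean.
    Replacing [w] by [- w] flips the cross terms, so the two resulting autocorrelations add up to
    [4 * autocor u]. *)
Lemma autocor_split (w : R[i]) u a x : w * Num.conj w = 1 -> buc u ->
  autocor (fun z => u z + w * u (z + a)) x =
  2 * autocor u x + (w * autocor u (x + a) + Num.conj w * autocor u (x - a)).
Proof.
move=> w1 bu; have bt y := buc_autocor_term y bu.
have h1 : autocor u x = cmean (fun z => u (x + (z + a)) * Num.conj (u (z + a))).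
  by rewrite (cmean_shift G_compact a (bt x)).
have h2 : autocor u (x - a) = cmean (fun z => u (x + z) * Num.conj (u (z + a))).
  rewrite /autocor -(cmean_shift G_compact a (bt (x - a))); congr cmean.
  by apply/funext => z; rewrite addrACA addNr addr0.
have b1 : buc (fun z => u (x + (z + a)) * Num.conj (u (z + a))) by exact: (bS a (bt x)).
have b2 : buc (fun z => u (x + z) * Num.conj (u (z + a))).
  by apply: bM; [exact: buc_shiftl|exact/bJ/bS].
rewrite mulr_natl mulr2n {2}h1 h2 {1 2}/autocor -(cmeanZ _ (Num.conj w)) //.
rewrite -(cmean_lin _ w) //; last exact: bM (bC _) b2.
rewrite -!cmeanD //; first last.
- by apply: bD; [exact: bM (bC _) (bt _)|exact: bM (bC _) b2].
- exact: bD.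
congr cmean; apply/funext => z; rewrite conjD conjM [x + a + z]addrAC -[x + z + a]addrA.
transitivity (u (x + z) * Num.conj (u z) +
  (w * Num.conj w) * (u (x + (z + a)) * Num.conj (u (z + a))) +
  (w * (u (x + (z + a)) * Num.conj (u z)) + Num.conj w * (u (x + z) * Num.conj (u (z + a))))).
  by rewrite addrA; ring.
by rewrite w1 mul1r.
Qed.

Definition conv g f (x : G) : R[i] := cmean (fun y => g (x - y) * f y).

Lemma buc_conv_term g f x : buc g -> buc f -> buc (fun y => g (x - y) * f y).
Proof. by move=> bg bf; apply: bM => //; exact: buc_reflect. Qed.

Lemma conv_bound g f (N M : R) x : buc g -> buc f ->
  (forall y, cabs (g y) <= N) -> (forall y, cabs (f y) <= M) ->
  cabs (conv g f x) <= N * M.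
Proof.
move=> bg bf hN hM; apply: cmean_le_cst => //; first exact: buc_conv_term.
by move=> y; rewrite cabsM ler_pM ?cabs_ge0.
Qed.

Lemma conv_lin g f h (k : R[i]) x : buc g -> buc f -> buc h ->
  conv g (fun y => k * f y + h y) x = k * conv g f x + conv g h x.
Proof.
move=> bg bf bh; rewrite /conv -cmean_lin //; [|exact: buc_conv_term..].
by congr cmean; apply/funext => y; ring.
Qed.

Lemma convZ g f (k : R[i]) x : buc g -> buc f ->
  conv g (fun y => k * f y) x = k * conv g f x.
Proof.
move=> bg bf; rewrite /conv -cmeanZ //; last exact: buc_conv_term.
by congr cmean; apply/funext => y; ring.
Qed.

Lemma conv_shift g f a x : buc g -> buc f ->
  conv g (fun y => f (y + a)) x = conv g f (x + a).
Proof.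
move=> bg bf; rewrite /conv -(cmean_shift G_compact a (buc_conv_term (x + a) bg bf)).
by congr cmean; apply/funext => y; rewrite opprD addrACA subrr addr0.
Qed.

(** The translation is moved onto [g], so the modulus of continuity depends on [f] only through its
    bound. This makes the maximizing sequence below equicontinuous. *)
Lemma conv_equi g f (e M : R) v : buc g -> buc f ->
  (forall x, cabs (g (x + v) - g x) < e) -> (forall y, cabs (f y) <= M) ->
  forall x, cabs (conv g f (x + v) - conv g f x) <= e * M.
Proof.
move=> bg bf he hM x.
have -> : conv g f (x + v) - conv g f x =
    cmean (fun y => (g (x - y + v) - g (x - y)) * f y).
  rewrite addrC -mulN1r -cmean_lin //; [|exact: buc_conv_term..].
  congr cmean; apply/funext => y; rewrite addrAC; ring.
apply: cmean_le_cst => //.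
  apply: bM => //.
  have := bD (buc_reflect G_compact x (bS v bg)) (bM (bC (-1)) (buc_reflect G_compact x bg)).
  by congr buc; apply/funext => y; ring.
by move=> y; rewrite cabsM ler_pM ?cabs_ge0 // ltW.
Qed.

Lemma buc_conv g f : buc g -> buc f -> buc (conv g f).
Proof.
move=> bg bf; have [[M hM] _] := bf; have [_ ug] := bg.
have M0 : 0 <= M := le_trans (cabs_ge0 _) (hM 0).
apply: unif_cont_buc => // e e0.
have d0 : 0 < e / (M + 1) by rewrite divr_gt0 //; lra.
apply: filterS (ug _ d0) => v hv x.
apply: le_lt_trans (conv_equi bg bf hv hM x) _.
have : e / (M + 1) * (M + 1) = e by rewrite divfK // gt_eqF //; lra.
move: d0; set d := e / _; nra.
Qed.

(** With p = (2 + 2r)/4 and q = (2 - 2r)/4 the left side is at most 16 p q (K - c1) = 4 (1 - r^2) (K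
    - c1). *)
Lemma split_bound (a1 b1 c1 r K : R) : 0 <= 2 + 2 * r -> 0 <= 2 - 2 * r ->
  a1 <= K * (2 + 2 * r) ^+ 2 -> b1 <= K * (2 - 2 * r) ^+ 2 -> c1 <= K ->
  (2 - 2 * r) / 4 * a1 + (2 + 2 * r) / 4 * b1 -
    (2 + 2 * r) / 4 * ((2 - 2 * r) / 4) * (4 ^+ 2 * c1) <= 4 * (K - c1).
Proof.
move=> p0 q0 hp hq Kc.
have h1 : (2 - 2 * r) / 4 * a1 <= (2 - 2 * r) / 4 * (K * (2 + 2 * r) ^+ 2).
  by apply: ler_wpM2l => //; rewrite divr_ge0.
have h2 : (2 + 2 * r) / 4 * b1 <= (2 + 2 * r) / 4 * (K * (2 - 2 * r) ^+ 2).
  by apply: ler_wpM2l => //; rewrite divr_ge0.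
have : 0 <= r ^+ 2 * (K - c1) by rewrite mulr_ge0 ?sqr_ge0 // subr_ge0.
by move=> *; lra.
Qed.

(* If [u] nearly maximizes [energy (conv g (autocor u))] among functions of
   energy 1, then writing [4 autocor u] as the sum of the autocorrelations of
   [u +- w u(. + a)] forces each summand to contribute almost proportionally,
   by strict convexity of the energy. *)
Lemma energy_split g u (K : R) (w : R[i]) a : buc g -> buc u ->
  (forall v, buc v -> energy (conv g (autocor v)) <= K * energy v ^+ 2) ->
  energy u = 1 -> w * Num.conj w = 1 ->
  forall eta, eta = conv g (autocor u) ->
  energy (fun x => w * eta (x + a) + Num.conj w * eta (x - a)
    - (2 * complex.Re (w * autocor u a))%:C * eta x) <= 4 * (K - energy eta).
Proof.
move=> bg bu hK E1 w1 eta etaE.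
have w1' : - w * Num.conj (- w) = 1 by rewrite conjN mulrNN.
have bp : buc (fun z => u z + w * u (z + a)) by exact: bD bu (bM (bC w) (bS a bu)).
have bq : buc (fun z => u z + - w * u (z + a)) by exact: bD bu (bM (bC (- w)) (bS a bu)).
set up := fun z => _ in bp; set un := fun z => _ in bq.
have ba := buc_autocor bu.
have bap := buc_autocor bp; have baq := buc_autocor bq.
have be : buc eta by rewrite etaE; exact: buc_conv.
pose r := complex.Re (w * autocor u a).
have ReE : w * autocor u a + Num.conj w * Num.conj (autocor u a) = (2 * r)%:C.
  rewrite -conjM /r; case: (w * autocor u a) => x y.
  by apply/eqP; rewrite eq_complex /= ; apply/andP; split; apply/eqP; ring.
have Ep : energy up = 2 + 2 * r.
  apply: complexI; rewrite -autocor0 /up autocor_split // add0r sub0r autocorN //.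
  by rewrite ReE autocor0 E1 rcD rc1 mulr1 rc_nat.
have Eq : energy un = 2 - 2 * r.
  apply: complexI; rewrite -autocor0 /un autocor_split // add0r sub0r autocorN //.
  by rewrite conjN !mulNr -opprD ReE autocor0 E1 rcB rc1 mulr1 rc_nat.
pose A := conv g (autocor up); pose B := conv g (autocor un).
have bA : buc A by exact: buc_conv.
have bB : buc B by exact: buc_conv.
have convE (v : R[i]) x : conv g (fun x => 2 * autocor u x +
    (v * autocor u (x + a) + Num.conj v * autocor u (x - a))) x =
    2 * eta x + (v * eta (x + a) + Num.conj v * eta (x - a)).
  have b1 := bS a ba; have b2 := bS (- a) ba.
  rewrite (conv_lin 2 x bg ba (bD (bM (bC v) b1) (bM (bC (Num.conj v)) b2))).
  rewrite (conv_lin v x bg b1 (bM (bC (Num.conj v)) b2)) (convZ (Num.conj v) x bg b2).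
  by rewrite (conv_shift a x bg ba) (conv_shift (- a) x bg ba) etaE.
have AE x : A x = 2 * eta x + (w * eta (x + a) + Num.conj w * eta (x - a)).
  by rewrite -(convE w x); congr (conv g _ x); apply/funext => y; exact: autocor_split.
have BE x : B x = 2 * eta x - (w * eta (x + a) + Num.conj w * eta (x - a)).
  have -> : 2 * eta x - (w * eta (x + a) + Num.conj w * eta (x - a)) =
      2 * eta x + (- w * eta (x + a) + Num.conj (- w) * eta (x - a)).
    by rewrite conjN !mulNr opprD.
  by rewrite -(convE (- w) x); congr (conv g _ x); apply/funext => y; exact: autocor_split.
have hp := hK _ bp; have hq := hK _ bq.
have Ep0 := energy_ge0 G_compact bp; have Eq0 := energy_ge0 G_compact bq.
rewrite -/A -/B Ep Eq in hp hq Ep0 Eq0.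
(* The weights are the shares of the energies [2 + 2 * r] and [2 - 2 * r] in their total 4. *)
have pq1 : (2 + 2 * r) / 4 + (2 - 2 * r) / 4 = 1 by field.
have := energy_convex G_compact bA bB pq1.
have -> : (fun x => A x + B x) = (fun x => 4 * eta x).
  by apply/funext => x; rewrite AE BE; ring.
rewrite energyZ // (_ : cabs 4 = 4); last first.
  by rewrite -(rc_nat R 4) cabs_real ger0_norm.
have -> : (fun x => A x - ((2 + 2 * r) / 4)%:C * (A x + B x)) =
    (fun x => w * eta (x + a) + Num.conj w * eta (x - a) - (2 * r)%:C * eta x).
  apply/funext => x; rewrite AE BE rcM rcD rcV !rc_nat.
  by field.
move=> ->; apply: split_bound => //.
by have := hK _ bu; rewrite -etaE E1 expr1n mulr1.
Qed.

(* [energy_split] with [w = 1] and [w = 'i]: the combination [D1 - 'i * D2]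
   eliminates the translate by [- a]. *)
Lemma near_maximizer g u (K : R) a : buc g -> buc u ->
  (forall v, buc v -> energy (conv g (autocor v)) <= K * energy v ^+ 2) ->
  energy u = 1 ->
  forall eta, eta = conv g (autocor u) ->
  energy (fun x => eta (x + a) - autocor u a * eta x) <= 4 * (K - energy eta).
Proof.
move=> bg bu hK E1 eta etaE.
have be : buc eta by rewrite etaE; apply: buc_conv => //; exact: buc_autocor.
have i1 : 'i * Num.conj 'i = 1 :> R[i].
  by apply/eqP; rewrite eq_complex /=; apply/andP; split; apply/eqP; ring.
have h1 := energy_split a bg bu hK E1 (etrans (mul1r _) (rmorph1 _)) etaE.
have h2 := energy_split a bg bu hK E1 i1 etaE.
move: h1 h2; set D1 := fun x => _; set D2 := fun x => _ => h1 h2.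
have b1 := bS a be; have b2 := bS (- a) be.
have bD1 : buc D1.
  have := bD (bD (bM (bC 1) b1) (bM (bC (Num.conj 1)) b2))
    (bM (bC (- (2 * complex.Re (1 * autocor u a))%:C)) be).
  by congr buc; apply/funext => x; rewrite /D1 mulNr.
have bD2 : buc D2.
  have := bD (bD (bM (bC 'i) b1) (bM (bC (Num.conj 'i)) b2))
    (bM (bC (- (2 * complex.Re ('i * autocor u a))%:C)) be).
  by congr buc; apply/funext => x; rewrite /D2 mulNr.
have -> : (fun x => eta (x + a) - autocor u a * eta x) =
    (fun x => 2^-1 * D1 x + (- ('i / 2)) * D2 x).
  apply/funext => x; rewrite /D1 /D2.
  apply: (mulfI (_ : 2 != 0 :> R[i])); first by rewrite pnatr_eq0.
  have aux (P Q : R[i]) : 2 * (2^-1 * P + - ('i / 2) * Q) = P - 'i * Q by field.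
  rewrite aux -(rc_nat R 2); case: (autocor u a) (eta x) (eta (x + a)) (eta (x - a)) =>
    [p q] [x1 x2] [y1 y2] [z1 z2].
  by apply/eqP; rewrite eq_complex /=; apply/andP; split; apply/eqP; field.
have := energyD_le G_compact (bM (bC 2^-1) bD1) (bM (bC (- ('i / 2))) bD2).
rewrite !energyZ // cabsN cabsM !cabsV.
have -> : cabs (2 : R[i]) = 2 by rewrite -(rc_nat R 2) cabs_real ger0_norm.
have -> : cabs ('i : R[i]) = 1.
  rewrite /cabs normc_def /= expr0n /= add0r expr1n sqrtr1 //.
move: (energy D1) (energy D2) h1 h2 => *; lra.
Qed.

(** * Ultralimits and the limit character *)

Lemma ultralimit (F : set_system nat) (z : nat -> R[i]) : UltraFilter F ->
  (exists M : R, forall n, cabs (z n) <= M) ->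
  exists l : R[i], forall e : R, 0 < e -> F [set n | cabs (z n - l) < e].
Proof.
move=> FU [M hM].
have real_lim (x : nat -> R) : (forall n, `|x n| <= M) ->
    exists l : R, forall e : R, 0 < e -> F [set n | `|x n - l| < e].
  move=> hx; have FxU : UltraFilter (x @ F).
    split; first exact: fmap_proper_filter.
    move=> H PH xFH; apply/seteqP; split => // A HA.
    have [//|FA] := in_ultra_setVsetC (x @^-1` A) FU.
    have : H (~` A) by apply: xFH.
    move=> /(filterI HA); rewrite setICr => /filter_not_empty //.
  have := @segment_compact R (- M) M; rewrite compact_ultra => /(_ _ FxU).
  case=> [|l [_ hl]].
    apply: (@filterS _ F _ setT) => [n _|]; last exact: filterT.
    by rewrite /= in_itv /= -ler_norml.
  exists l => e e0; move/cvgrPdist_lt : hl => /(_ e e0).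
  by apply: filterS => n /=; rewrite distrC.
have [a ha] : exists l : R, forall e : R, 0 < e -> F [set n | `|complex.Re (z n) - l| < e].
  by apply: real_lim => n; apply: le_trans (hM n); exact: Re_le_cabs.
have [b hb] : exists l : R, forall e : R, 0 < e -> F [set n | `|complex.Im (z n) - l| < e].
  by apply: real_lim => n; apply: le_trans (hM n); exact: Im_le_cabs.
exists (a +i* b) => e e0; have e2 : 0 < e / 2 by lra.
apply: filterS (filterI (ha _ e2) (hb _ e2)) => n [/= h1 h2].
by apply: le_lt_trans (cabs_le_ReIm _) _; rewrite ReD ImD ReN ImN /=; lra.
Qed.

(** [K] is the supremum over functions of energy 1. Scaling [v] by t multiplies its autocorrelation
    by t^2 and the energy on the left by t^4, whence the square of [energy v]. In the second claim,
    the given [v] shows that the set of these energies is inhabited. *)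
Lemma energy_conv_le g : buc g -> exists2 K : R,
  (forall v, buc v -> energy (conv g (autocor v)) <= K * energy v ^+ 2) &
  forall e : R, 0 < e -> (exists2 v, buc v & 0 < energy (conv g (autocor v))) ->
    exists u, [/\ buc u, energy u = 1 & K - e < energy (conv g (autocor u))].
Proof.
move=> bg; pose S := [set energy (conv g (autocor u)) | u in [set u | buc u /\ energy u = 1]].
have [[N hN] _] := bg.
have ubS : ubound S (N ^+ 2).
  move=> _ [u [bu E1] <-]; have ba := buc_autocor bu.
  apply: energy_le => //; first exact: buc_conv.
  move=> x; rewrite -[N]mulr1; apply: conv_bound => // y.
  by rewrite -E1; exact: autocor_bound.
have scaled v : buc v -> 0 < energy v ->
    S (energy (conv g (autocor v)) / energy v ^+ 2).
  move=> bv v0; pose t := (Num.sqrt (energy v))^-1.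
  have t2 : t ^+ 2 = (energy v)^-1 by rewrite exprVn sqr_sqrtr // ltW.
  have t0 : 0 <= t by rewrite invr_ge0 sqrtr_ge0.
  exists (fun z => t%:C * v z).
    split; first exact: bM (bC _) bv.
    by rewrite energyZ // cabs_real ger0_norm // t2 mulVf // gt_eqF.
  rewrite (_ : autocor _ = fun x => (t ^+ 2)%:C * autocor v x); last first.
    by apply/funext => x; exact: autocorZ.
  rewrite (_ : conv _ _ = fun x => (t ^+ 2)%:C * conv g (autocor v) x); last first.
    by apply/funext => x; apply: convZ => //; exact: buc_autocor.
  rewrite energyZ //; last by apply: buc_conv => //; exact: buc_autocor.
  by rewrite cabs_real ger0_norm ?exprn_ge0// t2 exprVn mulrC.
exists (sup S) => [v bv|e e0 [v bv hv]].
  have ba := buc_autocor bv.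
  (* A function of energy 0 cannot be normalized, but [autocor_bound] makes its autocorrelation
     vanish. *)
  have := energy_ge0 G_compact bv; rewrite le_eqVlt => /orP[/eqP v0|v0].
    rewrite -v0 expr0n /= mulr0 -[leRHS](expr0n R 2).
    apply: energy_le => //; first exact: buc_conv.
    move=> x; rewrite -[leRHS](mulr0 N); apply: conv_bound => // y.
    by rewrite v0; exact: autocor_bound.
  rewrite -ler_pdivrMr ?exprn_gt0 //.
  by apply: ub_le_sup; [exists (N ^+ 2)|exact: scaled].
have v0 : 0 < energy v.
  rewrite lt_neqAle energy_ge0 // andbT; apply/eqP => v0.
  have ba := buc_autocor bv; move: hv; rewrite ltNge => /negP; apply.
  rewrite -[leRHS](expr0n R 2); apply: energy_le => //; first exact: buc_conv.
  move=> x; rewrite -[leRHS](mulr0 N); apply: conv_bound => // y.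
  by rewrite v0; exact: autocor_bound.
have hS : has_sup S.
  by split; [exists (energy (conv g (autocor v)) / energy v ^+ 2); exact: scaled|exists (N ^+ 2)].
by have [_ [u [bu E1] <-] hu] := sup_adherent e0 hS; exists u.
Qed.

Definition flim (F : set_system nat) (z : nat -> R[i]) (l : R[i]) :=
  forall e : R, 0 < e -> F [set n | cabs (z n - l) < e].

Lemma flim_le (F : set_system nat) z l (M : R) : ProperFilter F -> flim F z l ->
  (forall n, cabs (z n) <= M) -> cabs l <= M.
Proof.
move=> PF hl hM; apply/ler_addgt0Pl => e e0.
have [n /= hn] := filter_ex (hl e e0).
have := cabsD (l - z n) (z n); rewrite subrK cabsC; have := hM n; lra.
Qed.

Lemma flim_unique (F : set_system nat) z l m : ProperFilter F ->
  flim F z l -> flim F z m -> l = m.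
Proof.
move=> PF hl hm; apply/eqP; rewrite -subr_eq0 -cabs_eq0 eq_le cabs_ge0 andbT.
apply/ler_addgt0Pl => e e0; rewrite addr0; have e2 : 0 < e / 2 by lra.
have [n /= [h1 h2]] := filter_ex (filterI (hl _ e2) (hm _ e2)).
have := cabsD (l - z n) (z n - m); rewrite subrKA (cabsC l); lra.
Qed.

Lemma flimB (F : set_system nat) z w l m : Filter F -> flim F z l -> flim F w m ->
  flim F (fun n => z n - w n) (l - m).
Proof.
move=> FF hl hm e e0; have e2 : 0 < e / 2 by lra.
apply: filterS (filterI (hl _ e2) (hm _ e2)) => n /= [h1 h2].
have -> : z n - w n - (l - m) = (z n - l) - (w n - m) by ring.
by apply: le_lt_trans (cabsD _ _) _; rewrite cabsN; lra.
Qed.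

Lemma flimM (F : set_system nat) z w l m : Filter F -> flim F z l -> flim F w m ->
  flim F (fun n => z n * w n) (l * m).
Proof.
move=> FF hl hm e e0; have l0 := cabs_ge0 l; have m0 := cabs_ge0 m.
pose d := Num.min 1 (e / (cabs l + cabs m + 1)).
have d0 : 0 < d by rewrite lt_min ltr01 divr_gt0 //; lra.
have d1 : d <= 1 by rewrite ge_min lexx.
have de : d * (cabs l + cabs m + 1) <= e.
  by rewrite -ler_pdivlMr ?ge_min ?lexx ?orbT //; lra.
apply: filterS (filterI (hl _ d0) (hm _ d0)) => n /= [h1 h2].
have -> : z n * w n - l * m = (z n - l) * (w n - m) + l * (w n - m) + m * (z n - l) by ring.
apply: le_lt_trans (cabsD _ _) _; apply: le_lt_trans (lerD (cabsD _ _) (lexx _)) _.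
rewrite !cabsM; move: h1 h2 (cabs_ge0 (z n - l)) (cabs_ge0 (w n - m)).
move: (cabs (z n - l)) (cabs (w n - m)) => x y hx hy x0 y0.
have h1 : x * y <= x * 1 by apply: ler_wpM2l => //; lra.
have h2 : cabs l * y <= cabs l * d by apply: ler_wpM2l => //; lra.
have h3 : cabs m * x <= cabs m * d by apply: ler_wpM2l => //; lra.
nra.
Qed.

Lemma continuous_cabs (f : G -> R[i]^o) :
  (forall e : R, 0 < e -> \forall v \near (0 : G), forall x, cabs (f (x + v) - f x) <= e) ->
  continuous f.
Proof.
move=> h x; apply/cvgrPdist_le => e e0.
have eR : e = (complex.Re e)%:C by apply: complex_ge0; exact: ltW.
have e0' : 0 < complex.Re e by rewrite -ltcR -eR.
have : (fun y => y - x) @ x --> x - x.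
  apply: (@continuous_comp G (G * G)%type G (fun y => (y, x)) (fun z => z.1 - z.2)).
    by apply: cvg_pair; [exact: cvg_id|exact: cvg_cst].
  exact: sub_continuous.
rewrite subrr => /(_ _ (h _ e0')); rewrite /nbhs /= => H; apply: filterS H => y /= /(_ x).
by rewrite (addrC x) subrK eR -lecR -normE distrC.
Qed.

(* [g] is a coboundary in the direction [a0]: this is what rules out
   [c a0 = 1] for the limit character, see the last step. *)
Lemma limit_character g h a0 : buc h -> g = (fun x => h x - h (x - a0)) ->
  (exists2 v, buc v & 0 < energy (conv g (autocor v))) ->
  exists2 c : G -> R[i]^o, is_character c & c a0 != 1.
Proof.
move=> bh gE ex0.
have bg : buc g.
  rewrite gE; have := bD bh (bM (bC (-1)) (bS (- a0) bh)).
  by congr buc; apply/funext => x; rewrite mulN1r.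
have [K hK near_sup] := energy_conv_le bg.
have K0 : 0 < K.
  have [v bv] := ex0; have := hK v bv.
  have := sqr_ge0 (energy v); nra.
have /choice[u hu] (n : nat) : exists u, [/\ buc u, energy u = 1 &
    K - n.+1%:R^-1 < energy (conv g (autocor u))].
  by apply: near_sup => //; rewrite invr_gt0 ltr0n.
have bu n : buc (u n) by have [] := hu n.
have E1 n : energy (u n) = 1 by have [] := hu n.
pose psi n := autocor (u n); pose eta n := conv g (psi n); pose zeta n := conv h (psi n).
have bpsi n : buc (psi n) by exact: buc_autocor.
have beta n : buc (eta n) by exact: buc_conv.
have etaK n : K - n.+1%:R^-1 < energy (eta n) by have [] := hu n.
have psi1 n x : cabs (psi n x) <= 1 by rewrite -(E1 n); exact: autocor_bound.
have [[Ng hNg] ug] := bg; have [[Nh hNh] _] := bh.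
have etaB n x : cabs (eta n x) <= Ng by rewrite -[Ng]mulr1; exact: conv_bound.
have zetaB n x : cabs (zeta n x) <= Nh by rewrite -[Nh]mulr1; exact: conv_bound.
have equi (e : R) : 0 < e -> \forall v \near (0 : G), forall n x,
    cabs (eta n (x + v) - eta n x) <= e.
  move=> e0; apply: filterS (ug e e0) => v hv n x; rewrite -[e]mulr1.
  exact: conv_equi.
(* An ultrafilter finer than the tails gives all pointwise limits at once; no metrizability of [G]
   is available to extract subsequences. *)
have [F [FU Foo]] := @ultraFilterLemma nat \oo _.
have PF : ProperFilter F by exact: ultra_proper.
have FF : Filter F by exact: filter_filter.
have tail (e : R) : 0 < e -> F [set n | n.+1%:R^-1 < e].
  by move=> e0; apply: Foo; exact: near_infty_natSinv_lt (PosNum e0).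
have /choice[c hc] x : exists l, flim F (fun n => psi n x) l.
  by apply: ultralimit; exists 1.
have /choice[eta' heta] x : exists l, flim F (fun n => eta n x) l.
  by apply: ultralimit; exists Ng.
have /choice[zeta' hzeta] x : exists l, flim F (fun n => zeta n x) l.
  by apply: ultralimit; exists Nh.
(* [near_maximizer] controls the defect in energy only; equicontinuity makes the control pointwise.
   A defect at least [e] at [x] stays at least [e / 2] on x + U, so by [mean_lower] its energy is at
   least [k], against the bound by 4/(n+1). *)
have defect a x : flim F (fun n => eta n (x + a) - psi n a * eta n x) 0.
  move=> e e0; have e6 : 0 < e / 6 by lra.
  pose U := [set v : G | forall n x, cabs (eta n (x + v) - eta n x) <= e / 6].
  have [s hs] := finite_cover G_compact (equi _ e6 : nbhs 0 U).
  have s0 : 0 < (size s)%:R :> R by rewrite ltr0n; case: (hs 0) => y; case: (s).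
  pose k := (e / 2) ^+ 2 / (size s)%:R.
  have k0 : 0 < k by rewrite divr_gt0 // exprn_gt0 //; lra.
  have k4 : 0 < k / 4 by lra.
  apply: filterS (tail _ k4) => n /= hn; rewrite subr0 ltNge; apply/negP => hge.
  pose d y := eta n (y + a) - psi n a * eta n y.
  have bd : buc d.
    have := bD (bS a (beta n)) (bM (bC (- psi n a)) (beta n)).
    by congr buc; apply/funext => y; rewrite /d mulNr.
  have : k <= energy d.
    apply: (@mean_lower R G G_compact U s _ _ x (buc_cabs2 G_compact bd) hs) => [y|v /(_ n) hv]; first exact: sqr_ge0.
    rewrite ler_pXn2r ?nnegrE ?cabs_ge0 //; last lra.
    have h1 := hv (x + a); have h2 := hv x.
    have h3 : cabs (psi n a * (eta n (x + v) - eta n x)) <= e / 6.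
      rewrite cabsM -[leRHS]mul1r; apply: ler_pM; rewrite ?cabs_ge0 //.
    have i2 := cabsD (d x - d (x + v)) (d (x + v)); rewrite subrK in i2.
    have dE : d x - d (x + v) = psi n a * (eta n (x + v) - eta n x) -
        (eta n (x + a + v) - eta n (x + a)).
      by rewrite /d (addrAC x v a); move: (eta n) (psi n) => f1 f2; ring.
    have i1 := cabsD (psi n a * (eta n (x + v) - eta n x)) (- (eta n (x + a + v) - eta n (x + a))).
    rewrite cabsN -dE in i1.
    have := le_trans i2 (lerD (le_trans i1 (lerD h3 h1)) (lexx _)).
    move: hge; rewrite -/(d x) => {i1 i2 h1 h2 h3}.
    move: (cabs (d x)) (cabs (d (x + v))) => p q; lra.
  have h1 : energy d <= 4 * (K - energy (eta n)) := near_maximizer a bg (bu n) hK (E1 n) (erefl _).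
  have h2 := etaK n.
  move=> hE; suff : k < k by rewrite ltxx.
  apply: le_lt_trans hE _; apply: le_lt_trans h1 _.
  rewrite mulrC -ltr_pdivlMr //; apply: lt_trans hn.
  by rewrite ltrBlDl -ltrBlDr.
have etaM x a : eta' (x + a) = c a * eta' x.
  have := flimB FF (heta (x + a)) (flimM FF (hc a) (heta x)).
  by move=> /(flim_unique PF (defect a x)) /esym/eqP; rewrite subr_eq0 => /eqP.
(* Equicontinuity: were the limit zero, [eta n] would be uniformly small for
   some [n], against its energy being close to [K]. *)
have [x0 ex] : exists x, eta' x != 0.
  apply: contrapT => /forallNP h0.
  have {}h0 x : eta' x = 0 by apply/eqP; apply: contrapT => /negP /h0.
  pose e := Num.sqrt K / 4.
  have e2 : e ^+ 2 = K / 16 by rewrite exprMn sqr_sqrtr ?ltW // exprVn -natrX.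
  have e0 : 0 < e by rewrite divr_gt0 // sqrtr_gt0.
  pose U := [set v : G | forall n x, cabs (eta n (x + v) - eta n x) <= e].
  have [s hs] := finite_cover G_compact (equi _ e0 : nbhs 0 U).
  have Fs : F [set n | forall y, y \in s -> cabs (eta n y) < e].
    elim: (s) => [|y r IH]; first by apply: filterS (@filterT _ F _).
    have := heta y e e0; rewrite h0 => hy.
    apply: filterS (filterI hy IH) => n /= [h1 h2] z; rewrite inE => /orP[/eqP ->|/h2 //].
    by rewrite subr0 in h1.
  have K2 : 0 < K / 2 by lra.
  have [n /= [h1 h2]] := filter_ex (filterI Fs (tail _ K2)).
  have : energy (eta n) <= (2 * e) ^+ 2.
    apply: energy_le => // x; have [y ys /(_ n y)] := hs x.
    rewrite (addrC y) subrK; have := h1 y ys.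
    have := cabsD (eta n x - eta n y) (eta n y); rewrite subrK; lra.
  have -> : (2 * e) ^+ 2 = K / 4 by rewrite exprMn e2; field.
  move=> hE; suff : K < K by rewrite ltxx.
  have h3 : K - K / 2 < energy (eta n).
    by apply: le_lt_trans (etaK n); rewrite lerD2l lerN2 ltW.
  by have := lt_le_trans h3 hE; lra.
(* This quotient transfers to [c] the equicontinuity of the [eta n], which the [psi n] need not
   share. *)
have cE x : c x = eta' (x0 + x) / eta' x0 by rewrite etaM mulfK.
have c0 : c 0 = 1 by rewrite cE addr0 divff.
have cM x y : c (x + y) = c x * c y.
  by apply: (mulIf ex); rewrite -etaM addrA !etaM mulrA [c y * _]mulrC.
have c1 x : cabs (c x) <= 1 by apply: flim_le (hc x) _ => n.
exists c.
  split => //.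
  - apply: continuous_cabs => e e0.
    have d0 : 0 < e * cabs (eta' x0) by rewrite mulr_gt0 // lt_def cabs_ge0 cabs_eq0 ex.
    apply: filterS (equi _ d0) => v hv x.
    rewrite !cE -mulrBl cabsM cabsV ler_pdivrMr; last by rewrite lt_def cabs_ge0 cabs_eq0 ex.
    by apply: flim_le (flimB FF (heta _) (heta _)) _ => n; rewrite addrA.
  - move=> x; rewrite normE; suff -> : cabs (c x) = 1 by [].
    apply/eqP; rewrite eq_le c1 /=.
    (* Two numbers at most 1 with product 1 are both equal to 1. *)
    have : cabs (c x) * cabs (c (- x)) = 1 by rewrite -cabsM -cM subrr c0 cabs1.
    by have := c1 (- x); have := cabs_ge0 (c x); nra.
apply/eqP => ca.
have etaP x : eta' (x + a0) = eta' x by rewrite etaM ca mul1r.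
(* Convolution is linear in its first argument and commutes with translations, so the coboundary
   relation between [g] and [h] passes to the limits. *)
have etaZ x : eta' x = zeta' x - zeta' (x - a0).
  apply: (flim_unique PF (heta x)).
  have := flimB FF (hzeta x) (hzeta (x - a0)); congr (flim F).
  apply/funext => n; rewrite /eta /zeta /conv gE.
  rewrite addrC -mulN1r -cmean_lin //; [|exact: buc_conv_term..].
  by congr cmean; apply/funext => y; rewrite (addrAC x); ring.
(* [zeta'] would be unbounded on the multiples of [a0]. *)
have step n : zeta' (x0 + a0 *+ n) = zeta' x0 + n%:R * eta' x0.
  elim: n => [|n IH]; first by rewrite mulr0n addr0 mul0r addr0.
  have etan : eta' (x0 + a0 *+ n.+1) = eta' x0.
    elim: n.+1 => [|m IHm]; first by rewrite mulr0n addr0.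
    by rewrite mulrSr addrA etaP.
  have h1 := etaZ (x0 + a0 *+ n.+1); rewrite etan mulrSr addrA addrK in h1.
  have -> : zeta' (x0 + a0 *+ n.+1) = eta' x0 + zeta' (x0 + a0 *+ n).
    by rewrite h1 mulrSr addrA subrK.
  by rewrite IH -natr1; ring.
have zB x : cabs (zeta' x) <= Nh by apply: flim_le (hzeta x) _.
have pos : 0 < cabs (eta' x0) by rewrite lt_def cabs_ge0 cabs_eq0 ex.
have [n] : exists n : nat, 2 * Nh / cabs (eta' x0) < n%:R.
  by exists (Num.truncn (2 * Nh / cabs (eta' x0))).+1; exact: truncnS_gt.
rewrite ltr_pdivrMr // ltNge => /negP; apply.
have := zB (x0 + a0 *+ n); have := zB x0.
have := cabsD (zeta' (x0 + a0 *+ n)) (- zeta' x0).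
rewrite step addrAC subrr add0r cabsM cabsN -rc_nat cabs_real ger0_norm //; lra.
Qed.

(** * Bump functions and the separation of points *)

Hypothesis G_hausdorff : hausdorff_space G.

(** Urysohn's lemma in the normal space [G], for the point 0 and the complement of the interior of
    [U]. *)
Lemma bump (U : set G) : nbhs 0 U -> exists p : G -> R,
  [/\ continuous p, forall x, 0 <= p x, p 0 = 1 & forall x, p x != 0 -> U x].
Proof.
move=> U0.
have : uniform_separator (~` U°) [set (0 : G)].
  apply: (@normal_separatorP R G).1 => //.
  - exact: compact_normal.
  - exact/open_closedC/open_interior.
  - exact: accessible_closed_set1 (hausdorff_accessible G_hausdorff) _.
  - by apply/seteqP; split => // x [/= nU x0]; apply: nU; rewrite x0.
move=> /(@uniform_separatorP _ R)[p [cp rp pA pB]]; exists p; split => //.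
- by move=> x; have /= := rp (p x) (ex_intro2 _ _ x I erefl); rewrite in_itv /= => /andP[].
- by apply: (pB (p 0)); exists 0.
- move=> x px; apply: contrapT => nU; move/eqP: px; apply.
  by apply: (pA (p x)); exists x => //= /interior_subset.
Qed.

Lemma nbhs0_add (T : set G) : nbhs 0 T ->
  exists2 V : set G, nbhs 0 V & forall x y, V x -> V y -> T (x + y).
Proof.
have := @add_continuous G (0, 0); rewrite /continuous_at /= addr0 => h /h.
case=> -[A B] /= [A0 B0] AB; exists (A `&` B)%classic; first exact: filterI.
by move=> x y [Ax _] [_ By]; exact: (AB (x, y)).
Qed.

(** For a bump [p] of small support with autocorrelation [q], the translate by [a0] contributes
    nothing to g * q at 0. What remains is the mean of p(-y) q(y), which is positive, as
    [limit_character] requires. *)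
Lemma characters_separate (a0 : G) : a0 != 0 ->
  exists2 c : G -> R[i]^o, is_character c & c a0 != 1.
Proof.
move=> a00.
have T0 : nbhs (0 : G) [set x | x != a0].
  apply: open_nbhs_nbhs; split; last by rewrite /= eq_sym.
  have -> : [set x | x != a0] = ~` [set a0].
    by apply/seteqP; split => x /= /eqP.
  exact/closed_openC/(accessible_closed_set1 (hausdorff_accessible G_hausdorff)).
have [V1 V10 h1] := nbhs0_add T0; have [V2 V20 h2] := nbhs0_add V10.
have opp0 (W : set G) : nbhs 0 W -> nbhs (0 : G) [set x | W (- x)].
  have : (-%R : G -> G) @ (0 : G) --> (0 : G) by rewrite -{2}oppr0; exact: opp_continuous.
  by move=> h /h.
pose V := (V2 `&` [set x | V2 (- x)] `&` [set x | V1 (- x)])%classic.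
have V0 : nbhs 0 V by apply: filterI; [apply: filterI => //|]; exact: opp0.
(* If p(-y - a0) and q(y) were both nonzero, some z would have y + z, z and -y - a0 in [V]; but -(y
   + z) + z - (-y - a0) = a0. *)
have far v1 v2 v3 : V v1 -> V v2 -> V v3 -> - v1 + v2 - v3 != a0.
  move=> [[_ Vv1] _] [[Vv2 _] _] [_ Vv3]; apply: h1 => //; exact: h2.
have [p [cp p0 p1 pV]] := bump V0.
pose h : G -> R[i] := fun x => (p x)%:C.
have bh : buc h.
  apply: unif_cont_buc => // e e0; apply: filterS (continuous_unif G_compact cp e0) => v hv x.
  by rewrite /h -rcB cabs_real.
pose g := fun x => h x - h (x - a0).
apply: (limit_character bh (erefl g)); exists h => //.
have bg : buc g.
  have := bD bh (bM (bC (-1)) (bS (- a0) bh)).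
  by congr buc; apply/funext => x; rewrite mulN1r.
have ba := buc_autocor bh.
pose q x := mean (fun z => p (x + z) * p z).
have bpp x : bucR (fun z => p (x + z) * p z).
  have := bM (buc_shiftl x bh) bh; congr buc; apply/funext => z.
  by rewrite rcM.
have qE x : autocor h x = (q x)%:C.
  rewrite /autocor -cmean_real //; congr cmean; apply/funext => z.
  by rewrite conj_real rcM.
have q0 x : 0 <= q x by apply: mean_ge0 => // z; rewrite mulr_ge0.
have q00 : 0 < q 0.
  by apply: (@mean_gt0 R G G_compact _ 0) => // [z|]; rewrite ?mulr_ge0 // add0r p1 mulr1.
have vanish y : p (- y - a0) * q y = 0.
  apply: contrapT => /eqP; rewrite mulf_eq0 negb_or => /andP[pv qy].
  have [z] : exists z, p (y + z) * p z != 0.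
    apply: contrapT => /forallNP nz; move/eqP: qy; apply.
    rewrite /q (_ : (fun z => _) = fun=> 0) ?mean_cst //.
    by apply/funext => z; apply/eqP; apply: contrapT => /negP/nz.
  rewrite mulf_eq0 negb_or => /andP[/pV Vyz /pV Vz].
  have := far _ _ _ Vyz Vz (pV _ pv).
  rewrite (_ : _ - _ = a0) ?eqxx //.
  by rewrite [- (y + z)]opprD subrK subKr.
have bpq : bucR (fun y => p (0 - y) * q y).
  have := bM (buc_reflect G_compact 0 bh) ba; congr buc; apply/funext => y.
  by rewrite qE rcM.
apply: (@mean_gt0 R G G_compact _ 0) => //; [by apply: buc_cabs2 => //; exact: buc_conv | by move=> x; exact: sqr_ge0|].
rewrite exprn_gt0 //.
have -> : conv g (autocor h) 0 = (mean (fun y => p (0 - y) * q y))%:C.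
  rewrite /conv -cmean_real //; congr cmean; apply/funext => y.
  rewrite qE /g /h mulrBl -!rcM (_ : p (0 - y - a0) * q y = 0) ?subr0 //.
  by rewrite sub0r vanish.
have m0 : 0 < mean (fun y => p (0 - y) * q y).
  apply: (@mean_gt0 R G G_compact _ 0) => // [y|]; first by rewrite mulr_ge0.
  by rewrite subr0 p1 mul1r.
by rewrite cabs_real ger0_norm // ltW.
Qed.

End Separation.

(** * Fourier series *)

Section FiniteSums.
Variable R : realType.

Lemma sum_le_subseq (T : eqType) (s t : seq T) (F : T -> R) : uniq s ->
  {subset s <= t} -> (forall x, 0 <= F x) -> \sum_(x <- s) F x <= \sum_(x <- t) F x.
Proof.
move=> + + F0; elim: s t => [|x s IH] t /=; first by rewrite big_nil sumr_ge0.
move=> /andP[xs us] st; rewrite big_cons (big_rem x (st x (mem_head _ _))) /=.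
rewrite lerD2l; apply: IH => // y ys.
have yx : y != x by apply: contraNneq xs => <-.
have := st y; rewrite inE ys orbT => /(_ isT).
by rewrite (perm_mem (perm_to_rem (st x (mem_head _ _)))) inE (negbTE yx).
Qed.

Lemma bounded_sums_prod (I J : choiceType) (p : I -> R) (q : J -> R) :
  (forall i, 0 <= p i) -> (forall j, 0 <= q j) ->
  bounded_sums p -> bounded_sums q -> bounded_sums (fun k : I * J => p k.1 * q k.2).
Proof.
move=> p0 q0 [M hM] [N hN]; exists (M * N) => B.
(* A finite set of pairs lies in the rectangle spanned by its two projections. *)
pose A1 := [fset k.1 | k in B]; pose A2 := [fset k.2 | k in B].
apply: (@le_trans _ _ ((\sum_(i <- A1) p i) * (\sum_(j <- A2) q j))); last first.
  by rewrite ler_pM ?sumr_ge0.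
have -> : (\sum_(i <- A1) p i) * (\sum_(j <- A2) q j) =
    \sum_(k <- [seq (i, j) | i <- A1, j <- A2]) p k.1 * q k.2.
  by rewrite big_distrlr big_allpairs_dep.
apply: sum_le_subseq => [|k kB|k]; [exact: fset_uniq| |by rewrite mulr_ge0].
by apply/allpairsP; exists k; split; rewrite ?in_imfset //; case: (k).
Qed.

End FiniteSums.

(** * Finite averages of characters and uniqueness of Fourier coefficients *)

Section CharacterAverages.
Variables (R : realType) (G : topologicalZmodType).
Implicit Types (gamma alpha beta : dual R G) (s t : seq G).

Lemma cabs_char gamma x : cabs (gamma x) = 1.
Proof. by have [_ h _] := char_funP gamma; apply: complexI; rewrite -normE h. Qed.

Lemma char_add gamma x y : gamma (x + y) = gamma x * gamma y.
Proof. by have [_ _ h] := char_funP gamma; exact: h. Qed.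

Lemma charM alpha beta x : char_fun (alpha + beta) x = alpha x * beta x.
Proof. by []. Qed.

Lemma char0 x : (0 : dual R G) x = 1.
Proof. by []. Qed.

Lemma char_conj gamma x : gamma x * Num.conj (gamma x) = 1.
Proof. by rewrite -sqr_cabs cabs_char expr1n. Qed.

Lemma charN gamma x : char_fun (- gamma) x = Num.conj (gamma x).
Proof.
have g0 : gamma x != 0 by rewrite -cabs_eq0 cabs_char oner_eq0.
by apply: (mulfI g0); rewrite -charM subrr char0 char_conj.
Qed.

Lemma char_at0 gamma : gamma 0 = 1.
Proof.
have g0 : gamma 0 != 0 by rewrite -cabs_eq0 cabs_char oner_eq0.
by apply: (mulfI g0); rewrite -char_add addr0 mulr1.
Qed.

Lemma char_mulrn gamma x n : gamma (x *+ n) = gamma x ^+ n.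
Proof. by elim: n => [|n IH]; rewrite ?char_at0 // mulrS char_add IH exprS. Qed.

Definition char_avg s gamma : R[i] := (size s)%:R^-1 * \sum_(x <- s) gamma x.

Lemma char_avg_le1 s gamma : cabs (char_avg s gamma) <= 1.
Proof.
rewrite cabsM cabsV -rc_nat cabs_real normr_nat.
have [->|n0] := eqVneq (size s)%:R (0 : R); first by rewrite invr0 mul0r.
have n1 : 0 < (size s)%:R :> R by rewrite lt_def n0 ler0n.
rewrite mulrC ler_pdivrMr // mul1r.
apply: le_trans (cabs_sum _ _) _.
under eq_bigr do rewrite cabs_char.
by rewrite big_const_seq count_predT iter_addr_0.
Qed.

(** Combining two averages multiplies their values, all of modulus at most 1, so a character already
    made small stays small. *)
Lemma char_avg_prod s t gamma :
  char_avg [seq x + y | x <- s, y <- t] gamma = char_avg s gamma * char_avg t gamma.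
Proof.
rewrite /char_avg size_allpairs natrM invfM mulrACA; congr (_ * _).
rewrite big_allpairs_dep /= big_distrlr /=.
by apply: eq_bigr => x _; apply: eq_bigr => y _; rewrite char_add.
Qed.

Lemma char_avgN s gamma : cabs (char_avg s (- gamma)) = cabs (char_avg s gamma).
Proof.
rewrite -[RHS]cabs_conj conjM conjV -rc_nat conj_real rmorph_sum rc_nat; congr (cabs (_ * _)).
by apply: eq_bigr => x _; rewrite charN.
Qed.

(** Average over the multiples of a point [x] where [gamma x] differs from 1: the geometric sum
    stays below 2 / |gamma(x) - 1|, whatever its length. *)
Lemma char_avg_small gamma (e : R) : gamma != 0 -> 0 < e ->
  exists2 s, s != [::] & cabs (char_avg s gamma) <= e.
Proof.
move=> g0 e0; have [x gx] : exists x, gamma x != 1.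
  apply: contrapT => /forallNP h; move/eqP: g0; apply.
  by apply/char_fun_inj/funext => x; apply/eqP; apply: contrapT => /negP/(h x).
set z := gamma x in gx; have d0 : 0 < cabs (z - 1).
  by rewrite lt_def cabs_ge0 cabs_eq0 subr_eq0 gx.
pose n := (Num.truncn (2 / (e * cabs (z - 1)))).+1.
exists [seq x *+ i | i <- iota 0 n] => //.
rewrite /char_avg size_map size_iota big_map.
have -> : \sum_(i <- iota 0 n) gamma (x *+ i) = \sum_(i < n) z ^+ i.
  by rewrite -(big_mkord xpredT (fun i => z ^+ i)) /index_iota subn0; apply: eq_bigr => i _; exact: char_mulrn.
have h : cabs (\sum_(i < n) z ^+ i) <= 2 / cabs (z - 1).
  rewrite ler_pdivlMr // mulrC -cabsM -subrX1.
  apply: le_trans (cabsD _ _) _.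
  by rewrite cabsN cabs1 cabsX cabs_char expr1n.
rewrite cabsM cabsV -rc_nat cabs_real normr_nat mulrC ler_pdivrMr ?ltr0n //.
apply: le_trans h _; rewrite ler_pdivrMr // mulrAC -ler_pdivrMl ?mulr_gt0 //.
by rewrite mulrC ltW //; exact: truncnS_gt.
Qed.

Lemma char_avg_small_seq (r : seq (dual R G)) (e : R) : 0 < e ->
  exists2 s, s != [::] & forall gamma, gamma \in r -> gamma != 0 ->
  cabs (char_avg s gamma) <= e.
Proof.
move=> e0; elim: r => [|g r [s s0 IH]]; first by exists [:: 0].
have [->|g0] := eqVneq g 0.
  exists s => // gamma; rewrite inE => /orP[/eqP ->|]; last exact: IH.
  by rewrite eqxx.
have [t t0 ht] := char_avg_small g0 e0.
exists [seq x + y | x <- s, y <- t]; first exact: allpairs_neq0.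
move=> gamma; rewrite inE char_avg_prod cabsM => /orP[/eqP -> _|gr gamma0].
  by rewrite -[e]mul1r ler_pM ?cabs_ge0 ?char_avg_le1.
by rewrite -[e]mulr1 ler_pM ?cabs_ge0 ?char_avg_le1 ?IH.
Qed.

(* Averaging over a suitable finite set isolates the coefficient at [gamma0]
   of an absolutely summable family; this replaces orthogonality of characters
   with respect to Haar measure. *)
Lemma char_avg_isolate (b : dual R G -> R) gamma0 (e : R) :
  (forall gamma, 0 <= b gamma) -> bounded_sums b -> 0 < e ->
  exists2 s, s != [::] & forall B : {fset dual R G},
    \sum_(gamma <- B) (gamma != gamma0)%:R *
      (b gamma * cabs (char_avg s (gamma - gamma0))) <= e.
Proof.
move=> b0 sb e0; have e2 : 0 < e / 2 by lra.
have [A hA] := bounded_sums_tail b0 sb e2; have [M hM] := sb.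
have M0 : 0 <= M by apply: le_trans (hM fset0); rewrite big_seq_fset0.
(* Outside [A] the averages are bounded by 1 and the tail by [e / 2]. On [A] the averages are at
   most this number and the total weight at most [M]. *)
have d0 : 0 < e / 2 / (M + 1) by rewrite divr_gt0 //; lra.
have [s s0 hs] := char_avg_small_seq [seq g - gamma0 | g <- A] d0.
exists s => // B.
pose F gamma := (gamma != gamma0)%:R * (b gamma * cabs (char_avg s (gamma - gamma0))).
have F0 g : 0 <= F g by rewrite /F !mulr_ge0 ?cabs_ge0.
have Fb g : F g <= b g.
  rewrite /F; case: (g != gamma0); rewrite ?mul0r ?mul1r ?b0 //.
  by rewrite -[leRHS]mulr1 ler_wpM2l // char_avg_le1.
apply: (le_trans (fsum_le F0 (fsubsetUr A B))).
rewrite (fsum_split F (fsubsetUl A B)).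
have hB : \sum_(i <- (A `|` B) `\` A) F i <= e / 2.
  apply: le_trans (ler_sum _ (fun g _ => Fb g)) _; exact: hA.
have : \sum_(i <- A) F i <= M * (e / 2 / (M + 1)).
  apply: (@le_trans _ _ (\sum_(i <- A) b i * (e / 2 / (M + 1)))); last first.
    by rewrite -mulr_suml ler_wpM2r // ltW.
  rewrite !big_seq; apply: ler_sum => g gA; rewrite /F.
  have [->|gn] := eqVneq g gamma0; first by rewrite mul0r mulr_ge0 // ltW.
  rewrite mul1r ler_wpM2l // hs //; first by apply/mapP; exists g.
  by rewrite subr_eq0.
have : e / 2 / (M + 1) * (M + 1) = e / 2 by rewrite divfK // gt_eqF //; lra.
move: d0 hB; set d := e / 2 / (M + 1); set S := \sum_(i <- _) _; set S' := \sum_(i <- A) _.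
move=> *; nra.
Qed.

Lemma has_sum_seq (I : choiceType) (T : Type) (r : seq T) (f : T -> I -> R[i]) (v : T -> R[i]) :
  (forall x, has_sum (f x) (v x)) ->
  has_sum (fun i => \sum_(x <- r) f x i) (\sum_(x <- r) v x).
Proof.
move=> h; elim: r => [|x r IH].
  rewrite big_nil => e e0; exists fset0 => B _.
  by rewrite big1 ?subr0 ?cabs0 // => i _; rewrite big_nil.
rewrite big_cons; apply: eq_has_sum (has_sumD (h x) IH) => i.
by rewrite big_cons.
Qed.

Lemma abs_summable_char (a : dual R G -> R[i]) x : abs_summable a ->
  abs_summable (fun gamma => a gamma * gamma x).
Proof. by apply: bounded_sums_le => g; rewrite cabsM cabs_char mulr1. Qed.

Lemma has_sum_fourier (a : dual R G -> R[i]) x : abs_summable a ->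
  has_sum (fun gamma => a gamma * gamma x) (fourier a x).
Proof. by move=> sa; apply/csumP/abs_summable_char. Qed.

Lemma fourier_eq (a : dual R G -> R[i]) (f : G -> R[i]^o) : abs_summable a ->
  (forall x, has_sum (fun gamma => a gamma * gamma x) (f x)) -> fourier a = f.
Proof.
by move=> sa h; apply/funext => x; exact: csum_eq (abs_summable_char x sa) (h x).
Qed.

(** Averaging conj(gamma0(x)) times the vanishing series over [s] leaves [a gamma0] plus an error
    that [char_avg_isolate] makes arbitrarily small. *)
Lemma fourier_eq0 (a : dual R G -> R[i]) : abs_summable a -> fourier a = 0 ->
  forall gamma0, a gamma0 = 0.
Proof.
move=> sa fa0 gamma0; apply/eqP; rewrite -cabs_eq0 eq_le cabs_ge0 andbT.
apply/ler_addgt0Pl => e e0; rewrite addr0.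
have [s s0 hs] := char_avg_isolate gamma0 (fun g => cabs_ge0 (a g)) sa e0.
have h1 : has_sum (fun gamma => a gamma * char_avg s (gamma - gamma0)) 0.
  have := has_sumZ (size s)%:R^-1 (has_sum_seq s
    (fun x => has_sumZ (Num.conj (gamma0 x)) (has_sum_fourier x sa))).
  rewrite fa0 big1 ?mulr0 => [|x _]; last by rewrite mulr0.
  apply: eq_has_sum => g; rewrite /char_avg [RHS]mulrCA; congr (_ * _).
  rewrite mulr_sumr; apply: eq_bigr => x _; rewrite charM charN; ring.
have h2 : has_sum (fun gamma => - ((gamma == gamma0)%:R * a gamma)) (- a gamma0).
  have := @has_sum_single R _ (fun gamma => - ((gamma == gamma0)%:R * a gamma)) gamma0.
  by rewrite eqxx mul1r; apply => g /negbTE ->; rewrite mul0r oppr0.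
have := has_sumD h1 h2; rewrite add0r => h3.
rewrite -cabsN; apply: has_sum_cabs_le h3 => B; apply: le_trans (hs B).
apply: ler_sum => g _; have [->|gn] := eqVneq g gamma0.
  rewrite subrr mul0r mul1r /char_avg; under eq_bigr do rewrite char0.
  rewrite big_const_seq count_predT iter_addr_0 mulVf ?mulr1 ?subrr ?cabs0 //.
  by rewrite pnatr_eq0 size_eq0.
by rewrite mul0r oppr0 addr0 cabsM mul1r.
Qed.

Lemma fourier_lin (k : R[i]) (a b : dual R G -> R[i]^o) : abs_summable a -> abs_summable b ->
  abs_summable (k *: a + b) /\ fourier (k *: a + b) = k *: fourier a + fourier b.
Proof.
move=> sa sb; have sab : abs_summable (k *: a + b).
  apply: bounded_sums_le (bounded_sumsD (bounded_sumsZ (cabs_ge0 k) sa) sb) => g.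
  by rewrite -cabsM; exact: cabsD.
split => //; apply: fourier_eq => // x.
apply: eq_has_sum (has_sumD (has_sumZ k (has_sum_fourier x sa)) (has_sum_fourier x sb)) => g.
by rewrite mulrA -mulrDl.
Qed.

Lemma fourier_inj (a b : dual R G -> R[i]^o) : abs_summable a -> abs_summable b ->
  fourier a = fourier b -> a = b.
Proof.
move=> sa sb ab; have [s e] := fourier_lin (-1) sb sa.
have := fourier_eq0 s; rewrite e ab scaleN1r addNr => /(_ erefl) h.
apply/funext => g; apply/eqP; rewrite -subr_eq0 addrC; apply/eqP.
by rewrite -[RHS](h g) scaleN1r.
Qed.

Lemma fcoefE (a : dual R G -> R[i]) : abs_summable a -> fcoef (fourier a) = a.
Proof.
move=> sa.
have [h1 h2] : [set b : dual R G -> R[i] | in_L1 b /\ fourier b = fourier a] (fcoef (fourier a)).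
  by apply: xgetPex; exists a; split => //; exact/in_L1P.
by apply: fourier_inj => //; exact/in_L1P.
Qed.

(** A term changes by |a(g)| |g(v) - 1|, independently of [x]. Finitely many terms are controlled by
    continuity of the characters at 0, the tail by |g(v) - 1| <= 2. *)
Lemma fourier_continuous (a : dual R G -> R[i]) : abs_summable a -> continuous (fourier a).
Proof.
move=> sa; apply: continuous_cabs => e e0; have e4 : 0 < e / 4 by lra.
have [A hA] := bounded_sums_tail (fun g => cabs_ge0 (a g)) sa e4; have [M hM] := sa.
have M0 : 0 <= M by apply: le_trans (hM fset0); rewrite big_seq_fset0.
have d0 : 0 < e / 2 / (M + 1) by rewrite divr_gt0 //; lra.
have near1 : \forall v \near (0 : G), forall g : dual R G, g \in (A : seq (dual R G)) ->
    cabs (g v - 1) <= e / 2 / (M + 1).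
  elim: (A : seq _) => [|g r IH]; first by apply: nearW => v.
  have hg : \forall v \near (0 : G), cabs (char_fun g v - 1) <= e / 2 / (M + 1).
    have [cg _ _] := char_funP g; have := cg 0.
    move=> /cvgrPdist_le/(_ (e / 2 / (M + 1))%:C).
    rewrite -(rmorph0 (real_complex R)) ltcR => /(_ d0); apply: filterS => v.
    by rewrite char_at0 distrC normE lecR.
  apply: filterS2 hg IH => v h1 h2 g'; rewrite inE => /orP[/eqP ->|/h2 //]; exact: h1.
apply: filterS near1 => v hv x.
have hx := has_sumD (has_sum_fourier (x + v) sa) (has_sumZ (-1) (has_sum_fourier x sa)).
rewrite mulN1r in hx; apply: has_sum_cabs_le hx => B.
have tE (g : dual R G) : cabs (a g * g (x + v) + -1 * (a g * g x)) = cabs (a g) * cabs (char_fun g v - 1).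
  rewrite char_add (_ : _ + _ = a g * g x * (g v - 1)); last by ring.
  by rewrite !cabsM cabs_char mulr1.
under eq_bigr do rewrite tE.
have F0 g : 0 <= cabs (a g) * cabs (char_fun g v - 1) by rewrite mulr_ge0 ?cabs_ge0.
apply: (le_trans (fsum_le F0 (fsubsetUr A B))).
rewrite (fsum_split _ (fsubsetUl A B)).
have h1 : \sum_(g <- A) cabs (a g) * cabs (char_fun g v - 1) <= M * (e / 2 / (M + 1)).
  apply: (@le_trans _ _ (\sum_(g <- A) cabs (a g) * (e / 2 / (M + 1)))); last first.
    by rewrite -mulr_suml ler_wpM2r // ltW.
  by rewrite !big_seq; apply: ler_sum => g gA; rewrite ler_wpM2l ?cabs_ge0 ?hv.
have h2 : \sum_(g <- (A `|` B) `\` A) cabs (a g) * cabs (char_fun g v - 1) <= e / 4 * 2.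
  apply: (@le_trans _ _ (\sum_(g <- (A `|` B) `\` A) cabs (a g) * 2)).
    apply: ler_sum => g _; rewrite ler_wpM2l ?cabs_ge0 //.
    by apply: le_trans (cabsD _ _) _; rewrite cabsN cabs_char cabs1.
  rewrite -mulr_suml ler_wpM2r //; exact: hA.
have : e / 2 / (M + 1) * (M + 1) = e / 2 by rewrite divfK // gt_eqF //; lra.
move: d0 h1 h2; set d := e / 2 / (M + 1); set S := \sum_(i <- _) _; set S' := \sum_(i <- _) _.
move=> *; nra.
Qed.

End CharacterAverages.

(** * The space H *)

Section HarmonicSpace.
Variables (R : realType) (G : topologicalZmodType) (lambda : dual R G -> R).
Hypothesis lambda_gt0 : forall gamma, 0 < lambda gamma.
Hypothesis lambda_sum : bounded_sums lambda.
Implicit Types (f g : G -> R[i]^o) (a b : dual R G -> R[i]^o) (gamma alpha : dual R G).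

Local Notation H := (harmonic_space lambda).
Local Notation ip := (harmonic_ip lambda).

(** Since |a| <= |a|^2 / lambda + lambda, summability of [lambda] turns weighted square summability
    into absolute convergence of the Fourier series. *)
Lemma l2_abs_summable a : l2 lambda a -> abs_summable a.
Proof.
move=> ha; apply: bounded_sums_le (bounded_sumsD ha lambda_sum) => g.
rewrite -lerBlDr ler_pdivlMr ?lambda_gt0 //.
have := sqr_ge0 (cabs (a g) - lambda g); have := lambda_gt0 g; have := cabs_ge0 (a g).
nra.
Qed.

(** Continuity and absolute summability follow from the weighted condition, so the space is the
    Fourier image of the weighted l^2. *)
Lemma harmonicP f : H f <-> exists2 a, l2 lambda a & f = fourier a.
Proof.
have pos a gamma : 0 <= cabs (a gamma) ^+ 2 / lambda gamma.
  by rewrite divr_ge0 ?sqr_ge0 // ltW.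
split=> [[_ [a [sa -> fa]]]|[a la ->]].
  by exists a => //; exact/(esum_ltyP (pos a)).
have sa := l2_abs_summable la; split; first exact: fourier_continuous.
by exists a; split => //; [exact/in_L1P|exact/(esum_ltyP (pos a))].
Qed.

Lemma harmonic_fourier a : l2 lambda a -> H (fourier a).
Proof. by move=> la; apply/harmonicP; exists a. Qed.

Lemma l2_fcoef f : H f -> l2 lambda (fcoef f).
Proof. by move=> /harmonicP[a la ->]; rewrite fcoefE //; exact: l2_abs_summable. Qed.

Lemma fourierK f : H f -> fourier (fcoef f) = f.
Proof. by move=> /harmonicP[a la ->]; rewrite fcoefE //; exact: l2_abs_summable. Qed.

Lemma harmonic_lin (k : R[i]) f g : H f -> H g ->
  H (k *: f + g) /\ fcoef (k *: f + g) = k *: (fcoef f : dual R G -> R[i]^o) + fcoef g.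
Proof.
move=> hf hg; have lf := l2_fcoef hf; have lg := l2_fcoef hg.
have lfg := l2_lin lambda_gt0 k lf lg.
have [s e] := fourier_lin k (l2_abs_summable lf) (l2_abs_summable lg).
rewrite !fourierK // in e; rewrite -e; split; first exact: harmonic_fourier.
by rewrite fcoefE.
Qed.

Lemma fcoefZ (k : R[i]) f : H f -> fcoef (k *: f) = k *: (fcoef f : dual R G -> R[i]^o).
Proof.
(* Writing k f = (k - 1) f + f avoids appealing to the coefficients of the zero function. *)
move=> hf; have [_] := harmonic_lin (k - 1) hf hf.
by rewrite !scalerBl !scale1r !subrK.
Qed.

Lemma fcoef_sum (T : Type) (s : seq T) (c : T -> R[i]) (u : T -> G -> R[i]^o) :
  H 0 -> (forall i, H (u i)) ->
  H (\sum_(i <- s) c i *: u i) /\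
  fcoef (\sum_(i <- s) c i *: u i) = fun gamma => \sum_(i <- s) c i * fcoef (u i) gamma.
Proof.
move=> h0 hu; elim: s => [|i s [IH1 IH2]].
  rewrite big_nil; split => //; have := fcoefZ 0 h0; rewrite !scale0r => ->.
  by apply/funext => gamma; rewrite big_nil.
rewrite big_cons; have [h1 ->] := harmonic_lin (c i) (hu i) IH1; split => //.
by rewrite IH2; apply/funext => gamma; rewrite big_cons.
Qed.

(** Everything is transported from the weighted l^2 along [fcoef]; the limit of a Cauchy sequence is
    the Fourier transform of the limit of its coefficients. *)
Lemma harmonic_hilbert : is_hilbert H ip.
Proof.
have [h1 h2 h3 h4] := l2_inner lambda_gt0.
split.
- apply/harmonicP; exists 0; first exact: l2_0.
  apply/esym/fourier_eq; first exact/l2_abs_summable/l2_0.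
  move=> x; have := @has_sum_fset R _ (fun gamma : dual R G => (0 : R[i]) * gamma x) fset0.
  by rewrite big_seq_fset0; apply => i _; rewrite mul0r.
- by move=> k f g hf hg; have [] := harmonic_lin k hf hg.
- move=> k f g h hf hg hh; have [_ e] := harmonic_lin k hf hg.
  by rewrite /harmonic_ip e; apply: h1; exact: l2_fcoef.
- by move=> f g hf hg; apply: h2; exact: l2_fcoef.
- by move=> f hf; apply: h3; exact: l2_fcoef.
- move=> f hf /h4 e; rewrite -(fourierK hf) e; last exact: l2_fcoef.
  apply: fourier_eq; first exact/l2_abs_summable/l2_0.
  move=> x; have := @has_sum_fset R _ (fun gamma : dual R G => (0 : R[i]) * gamma x) fset0.
  by rewrite big_seq_fset0; apply => i _; rewrite mul0r.
- move=> u hu cu.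
  have coefB f g : H f -> H g -> fcoef (f - g) = fcoef f - fcoef g :> (dual R G -> R[i]^o).
    move=> hf hg; have [_] := harmonic_lin (-1) hg hf.
    by rewrite !scaleN1r addrC => ->; rewrite addrC.
  have [|l ll hl] := l2_complete lambda_gt0 (u := fun n => fcoef (u n)) (fun n => l2_fcoef (hu n)).
    by move=> e /cu[N hN]; exists N => m n Nm Nn; rewrite -coefB //; exact: hN.
  exists (fourier l); first exact: harmonic_fourier.
  rewrite (_ : (fun n => _) = fun n => ip_norm (l2ip lambda) (fcoef (u n) - l)) //.
  apply/funext => n; rewrite -[l in RHS](fcoefE (l2_abs_summable ll)) -coefB //; exact: harmonic_fourier.
Qed.

(** * The reproducing kernel *)

Definition kernel_coef (x : G) : dual R G -> R[i]^o :=
  fun gamma => (lambda gamma)%:C * Num.conj (gamma x : R[i]).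

Lemma l2_kernel_coef x : l2 lambda (kernel_coef x).
Proof.
apply: bounded_sums_le lambda_sum => gamma.
rewrite cabsM cabs_conj cabs_char mulr1 cabs_real ger0_norm ?(ltW (lambda_gt0 gamma)) //.
by rewrite expr2 mulfK // gt_eqF.
Qed.

Lemma harmonic_kernelE x : harmonic_kernel lambda x = fourier (kernel_coef x).
Proof. by []. Qed.

Lemma fcoef_kernel x : fcoef (harmonic_kernel lambda x) = kernel_coef x.
Proof. by rewrite harmonic_kernelE fcoefE //; exact/l2_abs_summable/l2_kernel_coef. Qed.

(** The weight in the inner product cancels the factor [lambda] of the kernel, so [ip f] against the
    kernel section is term by term the Fourier series of [f] at [x]. *)
Lemma harmonic_kernel_sections : is_kernel_sections H ip (harmonic_kernel lambda).
Proof.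
move=> x; split=> [|f hf].
  by rewrite harmonic_kernelE; exact/harmonic_fourier/l2_kernel_coef.
rewrite /harmonic_ip fcoef_kernel -{1}(fourierK hf) /fourier; congr csum.
apply/funext => gamma; have l0 : (lambda gamma)%:C != 0 :> R[i] by rewrite rc_eq0 gt_eqF.
rewrite /kernel_coef conjM conj_real conjCK [(lambda gamma)%:C * _]mulrC.
by rewrite mulrA mulfK.
Qed.

Lemma harmonic_rkhs : is_rkhs H ip.
Proof.
have hH := harmonic_hilbert; split => // x f hf e e0.
have [kx rep] := harmonic_kernel_sections x.
set k := harmonic_kernel lambda x in kx rep; set N := ip_norm ip k.
have N0 : 0 <= N by exact: ip_norm_ge0.
exists (e / (N + 1)); first by rewrite divr_gt0 //; lra.
move=> g hg hgf; have hd := hilbertB hH hg hf.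
have -> : g x - f x = ip (g - f) k by rewrite -rep.
apply: le_lt_trans (ip_cauchy_schwarz hH hd kx) _.
have : ip_norm ip (g - f) * N <= e / (N + 1) * N by rewrite ler_wpM2r // ltW.
move=> /le_lt_trans; apply; rewrite mulrAC ltr_pdivrMr; last by lra.
by rewrite ltr_pM2l //; lra.
Qed.

(** * Characters inside the space and strict positive definiteness *)

Definition char_coef gamma0 : dual R G -> R[i]^o := fun gamma => (gamma == gamma0)%:R.

Lemma l2_char_coef gamma0 : l2 lambda (char_coef gamma0).
Proof.
exists (lambda gamma0)^-1 => A; have l0 : 0 <= (lambda gamma0)^-1 by rewrite invr_ge0 ltW.
apply: le_trans (fsum_single_le gamma0 A l0); apply: ler_sum => g _.
rewrite /char_coef; case: eqP => [->|_]; first by rewrite cabs1 expr1n mul1r.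
by rewrite cabs0 expr0n !mul0r.
Qed.

Lemma fourier_char gamma : fourier (char_coef gamma) = gamma :> (G -> R[i]^o).
Proof.
apply: fourier_eq; first exact/l2_abs_summable/l2_char_coef.
move=> x; have := @has_sum_single R _ (fun g : dual R G => char_coef gamma g * char_fun g x) gamma.
rewrite /char_coef eqxx mul1r; apply => g /negbTE ->; exact: mul0r.
Qed.

Lemma harmonic_char gamma : H gamma.
Proof. by rewrite -fourier_char; exact/harmonic_fourier/l2_char_coef. Qed.

Lemma fcoef_char gamma : fcoef gamma = char_coef gamma.
Proof. by rewrite -[in LHS]fourier_char fcoefE //; exact/l2_abs_summable/l2_char_coef. Qed.

Lemma ip_char alpha gamma : ip alpha gamma = (alpha == gamma)%:R / (lambda gamma)%:C.
Proof.
rewrite /harmonic_ip !fcoef_char; apply: csum_eq.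
  by apply: (abs_summable_ip lambda_gt0); exact: l2_char_coef.
have := @has_sum_single R _ (fun g : dual R G => char_coef alpha g * Num.conj (char_coef gamma g) / (lambda g)%:C) gamma.
have -> : char_coef alpha gamma * Num.conj (char_coef gamma gamma) = (alpha == gamma)%:R.
  by rewrite /char_coef eqxx rmorph1 mulr1 eq_sym.
apply => g /negbTE gn.
by rewrite /char_coef gn rmorph0 mulr0 mul0r.
Qed.

Lemma ip_char_kernel gamma x : ip gamma (harmonic_kernel lambda x) = gamma x.
Proof. by have [_ rep] := harmonic_kernel_sections x; rewrite -rep //; exact: harmonic_char. Qed.

(** Lagrange interpolation by characters. The weights [p] that preserve all the relations are stable
    under multiplication by gamma(x_k) - gamma(x_j), which vanishes at k = j; such factors remove
    every index except [i]. *)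
Lemma char_independent n (x : 'I_n -> G) (c : 'I_n -> R[i]) :
  (forall u v : G, u != v -> exists gamma, gamma u != gamma v) -> injective x ->
  (forall gamma, \sum_(j < n) c j * gamma (x j) = 0) -> forall i, c i = 0.
Proof.
move=> sep xI h0 i.
pose V (p : 'I_n -> R[i]) := forall gamma, \sum_(j < n) c j * p j * char_fun gamma (x j) = 0.
have ex (s : seq 'I_n) : i \notin s ->
    exists p, [/\ V p, p i != 0 & forall j, j \in s -> p j = 0].
  elim: s => [_|j s IH].
    exists (fun=> 1); split => [g||//]; last by rewrite oner_eq0.
    by under eq_bigr do rewrite mulr1; exact: h0.
  rewrite inE negb_or => /andP[ij /IH[p [Vp pi pj]]].
  have [g hg] : exists g : dual R G, char_fun g (x i) != char_fun g (x j).
    by apply: sep; rewrite (inj_eq xI).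
  exists (fun k => p k * (char_fun g (x k) - char_fun g (x j))); split.
  (* The relation for the new weights at [g'] is the old one at [g' + g] minus g(x_j) times the old
     one at [g']. *)
  - move=> g'; have h1 := Vp (g' + g); have h2 := Vp g'.
    transitivity (\sum_(k < n) c k * p k * char_fun (g' + g) (x k) -
        char_fun g (x j) * \sum_(k < n) c k * p k * char_fun g' (x k)).
      by rewrite mulr_sumr -sumrB; apply: eq_bigr => k _; rewrite charM; ring.
    by rewrite h1 h2 mulr0 subr0.
  - by rewrite mulf_neq0 // subr_eq0.
  - by move=> k; rewrite inE => /orP[/eqP ->|/pj ->]; rewrite ?subrr ?mulr0 ?mul0r.
have [|p [Vp pi pj]] := ex (rem i (enum 'I_n)); first by rewrite mem_rem_uniqF ?enum_uniq.
have := Vp 0; rewrite (bigD1 i) //= big1 ?addr0 => [|j ji].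
  by rewrite char0 mulr1 => /eqP; rewrite mulf_eq0 (negbTE pi) orbF => /eqP.
rewrite pj ?mulr0 ?mul0r //.
by rewrite (rem_filter _ (enum_uniq _)) mem_filter /= ji mem_enum.
Qed.

(** The quadratic form is the squared norm of [v]. If [v] vanishes, pairing it with each character
    yields a linear relation among the evaluations at the points, excluded by [char_independent]. *)
Lemma harmonic_strictly_posdef :
  (forall u v : G, u != v -> exists gamma : dual R G, gamma u != gamma v) ->
  strictly_posdef (kernel_fun ip (harmonic_kernel lambda)).
Proof.
move=> sep n x c xI [i ci]; have hH := harmonic_hilbert.
pose K j := harmonic_kernel lambda (x j).
have HK j : H (K j) by have [] := harmonic_kernel_sections (x j).
pose v := \sum_(j < n) Num.conj (c j) *: K j.
have hv : H v by apply: (hilbert_sum hH) => j; exact: (hilbertZ hH).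
have -> : \sum_(i < n) \sum_(j < n) c i * kernel_fun ip (harmonic_kernel lambda) (x i) (x j) *
    Num.conj (c j) = ip v v.
  rewrite {2}/v (ip_sumr hH) //; apply: eq_bigr => k _; rewrite conjCK /v (ip_suml hH) //.
  by rewrite mulr_sumr; apply: eq_bigr => j _; rewrite /kernel_fun -/(K k) -/(K j); ring.
rewrite lt_neqAle (ip_ge0 hH) // andbT eq_sym; apply/eqP => v0.
have {}v0 := ip_eq0 hH hv v0.
move/eqP: ci; apply; apply: char_independent sep xI _ i => gamma.
have hg := harmonic_char gamma.
transitivity (ip gamma v).
  rewrite /v (ip_sumr hH) //; apply: eq_bigr => j _.
  by rewrite conjCK ip_char_kernel.
rewrite v0; have h0 := hilbert_0 hH.
by rewrite (ip_conj hH h0 hg) (ip0l hH) // rmorph0.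
Qed.

(** [is_rkha] only asserts that some kernel sections exist. Two representers of the same evaluation
    differ by a vector orthogonal to the whole space, in particular to itself. *)
Lemma kernel_sections_unique k : is_kernel_sections H ip k ->
  forall x, k x = harmonic_kernel lambda x.
Proof.
move=> hk x; have hH := harmonic_hilbert.
have [h1 r1] := hk x; have [h2 r2] := harmonic_kernel_sections x.
set K := harmonic_kernel lambda x in h2 r2 *.
have hw := hilbertB hH h1 h2; apply/eqP; rewrite -subr_eq0; apply/eqP.
apply: (ip_eq0 hH hw).
have hN : H (- K) by rewrite -scaleN1r; exact: (hilbertZ hH).
have eN : ip (k x - K) (- K) = - ip (k x - K) K.
  by rewrite -[- K in X in ip _ X]scaleN1r (ipZr hH) // conjN rmorph1 mulN1r.
by rewrite (ipDr hH) // eN -r1 // -r2 // subrr.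
Qed.

End HarmonicSpace.

(** * The tensor square and the comultiplication *)

Section TensorProduct.
Variable R : realType.

(** Rectangles are cofinal among finite sets of pairs, and over a rectangle the sum factors. *)
Lemma has_sum_prod (I J : choiceType) (f : I -> R[i]) (g : J -> R[i]) s t :
  has_sum f s -> has_sum g t -> abs_summable (fun k : I * J => f k.1 * g k.2) ->
  csum (fun k : I * J => f k.1 * g k.2) = s * t.
Proof.
move=> hf hg sfg; have := csumP sfg; set v := csum _ => hv.
apply/eqP; rewrite -subr_eq0 -cabs_eq0 eq_le cabs_ge0 andbT.
apply/ler_addgt0Pl => e e0; rewrite addr0; have e2 : 0 < e / 2 by lra.
have s0 := cabs_ge0 s; have t0 := cabs_ge0 t.
(* For errors below [d <= 1] in both factors, the product errs by at most d (|s| + |t| + 1). *)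
pose d := Num.min 1 (e / 2 / (cabs s + cabs t + 1)).
have d0 : 0 < d by rewrite lt_min ltr01 divr_gt0 //; lra.
have d1 : d <= 1 by rewrite ge_min lexx.
have de : d * (cabs s + cabs t + 1) <= e / 2.
  by rewrite -ler_pdivlMr ?ge_min ?lexx ?orbT //; lra.
have [A hA] := hf d d0; have [B hB] := hg d d0; have [C hC] := hv _ e2.
pose A' := A `|` [fset k.1 | k in C]; pose B' := B `|` [fset k.2 | k in C].
have CAB : C `<=` A' `*` B'.
  apply/fsubsetP => k kC; rewrite in_fsetM !in_fsetU.
  by rewrite !in_imfset ?orbT.
have := hC _ CAB; have := hA _ (fsubsetUl _ _ : A `<=` A'); have := hB _ (fsubsetUl _ _ : B `<=` B').
have -> : \sum_(k <- A' `*` B') f k.1 * g k.2 = (\sum_(i <- A') f i) * (\sum_(j <- B') g j).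
  have -> : (\sum_(i <- A') f i) * (\sum_(j <- B') g j) =
      \sum_(k <- [seq (i, j) | i <- A', j <- B']) f k.1 * g k.2.
    by rewrite big_distrlr big_allpairs_dep.
  apply: perm_big; apply: uniq_perm; first exact: fset_uniq.
    apply: allpairs_uniq; [exact: fset_uniq|exact: fset_uniq|].
    by move=> [x1 y1] [x2 y2] _ _.
  move=> k; rewrite in_fsetM; apply/andP/allpairsP => [[h1 h2]|[p [h1 h2 ->]] //].
  by exists k; split => //; case: (k).
set S := \sum_(i <- _) f i; set T := \sum_(i <- _) g i => h2 h1 h3.
have -> : v - s * t = - (S * T - v) + ((S - s) * (T - t) + s * (T - t) + t * (S - s)) by ring.
apply: le_trans (cabsD _ _) _; rewrite cabsN.
have h4 : cabs ((S - s) * (T - t) + s * (T - t) + t * (S - s)) <= e / 2.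
  apply: le_trans (cabsD _ _) _; apply: le_trans (lerD (cabsD _ _) (lexx _)) _.
  rewrite !cabsM; move: h1 h2 (cabs_ge0 (S - s)) (cabs_ge0 (T - t)).
  move: (cabs (S - s)) (cabs (T - t)) => x y hx hy x0 y0.
  have i1 : x * y <= x * 1 by apply: ler_wpM2l => //; lra.
  have i2 : cabs s * y <= cabs s * d by apply: ler_wpM2l => //; lra.
  have i3 : cabs t * x <= cabs t * d by apply: ler_wpM2l => //; lra.
  nra.
by move: h3 h4; set x := cabs _; set y := cabs _; lra.
Qed.

(** * The Hilbert tensor square as l^2 of pairs of characters *)

Variables (G : topologicalZmodType) (lambda : dual R G -> R).
Hypothesis lambda_gt0 : forall gamma, 0 < lambda gamma.
Hypothesis lambda_sum : bounded_sums lambda.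
Implicit Types (f g u v : G -> R[i]^o) (gamma alpha beta : dual R G).

Local Notation H := (harmonic_space lambda).
Local Notation ip := (harmonic_ip lambda).
Local Notation I2 := (dual R G * dual R G)%type.

Definition lambda2 (p : I2) : R := lambda p.1 * lambda p.2.

Definition harmonic_tensor f g : I2 -> R[i]^o := fun p => fcoef f p.1 * fcoef g p.2.

Lemma lambda2_gt0 p : 0 < lambda2 p.
Proof. by rewrite mulr_gt0. Qed.

Lemma l2_tensor f g : H f -> H g -> l2 lambda2 (harmonic_tensor f g).
Proof.
move=> hf hg; have pos u alpha : 0 <= cabs (fcoef u alpha) ^+ 2 / lambda alpha.
  by rewrite divr_ge0 ?sqr_ge0 // ltW.
have := bounded_sums_prod (pos f) (pos g)
  (l2_fcoef lambda_gt0 lambda_sum hf) (l2_fcoef lambda_gt0 lambda_sum hg).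
by apply: bounded_sums_le => p; rewrite cabsM exprMn /lambda2 invfM mulrACA.
Qed.

Lemma l2ip_tensor f f' g g' : H f -> H f' -> H g -> H g' ->
  l2ip lambda2 (harmonic_tensor f g) (harmonic_tensor f' g') = ip f f' * ip g g'.
Proof.
move=> hf hf' hg hg'; have l u := l2_fcoef lambda_gt0 lambda_sum (f := u).
have := has_sum_prod (has_sum_ip lambda_gt0 (l _ hf) (l _ hf'))
  (has_sum_ip lambda_gt0 (l _ hg) (l _ hg')).
have E : (fun k : I2 => fcoef f k.1 * Num.conj (fcoef f' k.1) / (lambda k.1)%:C *
    (fcoef g k.2 * Num.conj (fcoef g' k.2) / (lambda k.2)%:C)) =
  (fun k => harmonic_tensor f g k * Num.conj (harmonic_tensor f' g' k) / (lambda2 k)%:C).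
  apply/funext => k; rewrite /harmonic_tensor /lambda2 conjM rcM invfM; ring.
rewrite E; apply; apply: (abs_summable_ip lambda2_gt0); exact: l2_tensor.
Qed.

(** Truncating [t] to a finite set of pairs gives a finite combination of tensors of characters, and
    the error is a tail of a convergent sum. *)
Lemma tensor_dense_l2 (t : I2 -> R[i]^o) : l2 lambda2 t -> forall e : R, 0 < e ->
  exists (n : nat) (u v : 'I_n -> G -> R[i]^o),
    [/\ forall i, H (u i), forall i, H (v i) &
      ip_norm (l2ip lambda2) (t - \sum_(i < n) harmonic_tensor (u i) (v i)) < e].
Proof.
move=> lt e e0; have hH := harmonic_hilbert lambda_gt0 lambda_sum.
have hc := harmonic_char lambda_gt0 lambda_sum.
have pos p : 0 <= cabs (t p) ^+ 2 / lambda2 p.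
  by rewrite divr_ge0 ?sqr_ge0 // ltW // lambda2_gt0.
have e4 : 0 < (e / 2) ^+ 2 by rewrite exprn_gt0 //; lra.
have [B hB] := bounded_sums_tail pos lt e4.
pose nt i := nth (0, 0) (B : seq I2) i.
exists #|` B|, (fun i => t (nt i) *: char_fun (nt i).1), (fun i => char_fun (nt i).2).
split=> [i|i|]; [exact: (hilbertZ hH)|exact: hc|].
have -> : \sum_(i < #|` B|) harmonic_tensor (t (nt i) *: char_fun (nt i).1) (char_fun (nt i).2)
   = (fun p => (p \in B)%:R * t p) :> (I2 -> R[i]^o).
  apply/funext => p; rewrite fct_sumE.
  rewrite (eq_bigr (fun i : 'I__ => (p == nt i)%:R * t p)); last first.
    move=> i _; rewrite /harmonic_tensor (fcoefZ lambda_gt0 lambda_sum) // !(fcoef_char lambda_gt0 lambda_sum).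
    have -> : (p == nt i) = (p.1 == (nt i).1) && (p.2 == (nt i).2) by [].
    rewrite /char_coef -[LHS]/(t (nt i) * (p.1 == (nt i).1)%:R * (p.2 == (nt i).2)%:R).
    case: eqP => [e1|_]; last by rewrite mulr0 !mul0r.
    case: eqP => [e2|_]; last by rewrite mulr0 mul0r.
    by rewrite mulr1 mul1r mulr1; congr t; case: (nt i) (p) e1 e2 => [? ?] [? ?] /= -> ->.
  rewrite -(big_mkord xpredT (fun i => (p == nt i)%:R * t p)).
  rewrite -(big_nth (0, 0) xpredT (fun q => (p == q)%:R * t p)).
  rewrite -mulr_suml; congr (_ * _).
  case: (boolP (p \in B)) => pB; last first.
    by rewrite big_seq big1 // => q qB; case: eqP pB => // ->; rewrite qB.
  rewrite (bigD1_seq p) ?fset_uniq //= eqxx big1 ?addr0 // => q qp.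
  by rewrite eq_sym (negbTE qp).
suff [_] : l2 lambda2 (t - (fun p => (p \in B)%:R * t p)) /\
    ip_norm (l2ip lambda2) (t - (fun p => (p \in B)%:R * t p)) <= e / 2.
  by move=> /le_lt_trans; apply; lra.
apply: (l2_norm_le lambda2_gt0) => [|A]; first lra.
apply: le_trans (hB A); set F := fun p => _.
have FE p : cabs ((t - (fun p => (p \in B)%:R * t p)) p) ^+ 2 / lambda2 p =
    (p \notin B)%:R * (cabs (t p) ^+ 2 / lambda2 p).
  rewrite !fctE; case: (p \in B); first by rewrite !mul1r mul0r subrr cabs0 expr0n mul0r.
  by rewrite mul0r mul1r subr0.
under eq_bigr do rewrite FE.
have F0 p : 0 <= (p \notin B)%:R * (cabs (t p) ^+ 2 / lambda2 p) by rewrite mulr_ge0.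
apply: (le_trans (fsum_le F0 (fsubsetUr B A))).
rewrite (fsum_split _ (fsubsetUl B A)) fsetDUl fsetDv fset0U.
rewrite big_seq big1 ?add0r => [|p ->]; last by rewrite mul0r.
by apply: ler_sum => p _; case: (p \in B); rewrite ?mul0r ?mul1r.
Qed.

Lemma harmonic_tensorP :
  is_hilbert_tensor H ip H ip (l2 lambda2) (l2ip lambda2) harmonic_tensor.
Proof.
split.
- exact: l2_hilbert lambda2_gt0.
- exact: l2_tensor.
- move=> k f f' g hf hf' hg; apply/funext => p.
  have [_ e] := harmonic_lin lambda_gt0 lambda_sum k hf hf'.
  by rewrite /harmonic_tensor e [LHS]mulrDl -mulrA.
- move=> k f g g' hf hg hg'; apply/funext => p.
  have [_ e] := harmonic_lin lambda_gt0 lambda_sum k hg hg'.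
  by rewrite /harmonic_tensor e [LHS]mulrDr mulrCA.
- by move=> f f' g g' hf hf' hg hg'; exact: l2ip_tensor.
- exact: tensor_dense_l2.
Qed.

(** * The comultiplication and its boundedness *)

Definition comult f : I2 -> R[i]^o := fun p =>
  (lambda2 p / lambda (p.1 + p.2))%:C * fcoef f (p.1 + p.2).

Lemma subconvolutive_fsum : subconvolutive lambda -> exists2 C : R, 0 <= C &
  forall gamma (A : {fset dual R G}),
    \sum_(alpha <- A) lambda alpha * lambda (gamma - alpha) <= C * lambda gamma.
Proof.
move=> [C hC].
have h gamma (A : {fset dual R G}) :
    \sum_(alpha <- A) lambda alpha * lambda (gamma - alpha) <= C * lambda gamma.
  rewrite -lee_fin; apply: le_trans (hC gamma).
  by apply: esum_ge_fsum => alpha; rewrite mulr_ge0 // ltW.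
(* The empty partial sum at the trivial character gives 0 <= C lambda(0), hence [C] is
   non-negative. *)
exists C => //; have := h 0 fset0; rewrite big_seq_fset0 pmulr_lge0 //.
Qed.

(** The change of variables (alpha, beta) -> (alpha + beta, alpha) turns the squared norm into a sum
    over gamma of |f^(gamma)|^2 (lambda * lambda)(gamma) / lambda(gamma)^2, at most [C] times the
    squared norm of [f]. *)
Lemma comult_bound : subconvolutive lambda -> exists M : R, forall f, H f ->
  l2 lambda2 (comult f) /\ ip_norm (l2ip lambda2) (comult f) <= M * ip_norm ip f.
Proof.
move=> /subconvolutive_fsum[C C0 hC]; exists (Num.sqrt C) => f hf.
have lf := l2_fcoef lambda_gt0 lambda_sum hf.
apply: (l2_norm_le lambda2_gt0); first by rewrite mulr_ge0 ?sqrtr_ge0 ?ip_norm_ge0.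
move=> B; rewrite exprMn sqr_sqrtr //.
pose F (k : I2) : R := lambda k.2 * lambda (k.1 - k.2) * (cabs (fcoef f k.1) ^+ 2 / lambda k.1 ^+ 2).
have F0 k : 0 <= F k.
  apply: mulr_ge0; first by apply: mulr_ge0; exact: ltW.
  by rewrite divr_ge0 ?sqr_ge0.
pose h (p : I2) : I2 := (p.1 + p.2, p.1).
have FE p : cabs (comult f p) ^+ 2 / lambda2 p = F (h p).
  rewrite /comult cabsM cabs_real ger0_norm; last first.
    by rewrite divr_ge0 // ltW ?lambda2_gt0.
  rewrite /F /h /= (addrC p.1) addrK /lambda2.
  have := lambda_gt0 p.1; have := lambda_gt0 p.2; have := lambda_gt0 (p.2 + p.1).
  move=> /gt_eqF/negbT x0 /gt_eqF/negbT y0 /gt_eqF/negbT z0.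
  by field; rewrite x0 y0 z0.
under eq_bigr do rewrite FE.
rewrite -(big_map h xpredT F).
(* The image of [B] under the injective [h] is enlarged to a rectangle, so that the inner sum
   becomes a partial sum of the convolution. *)
pose Gam : {fset dual R G} := [fset p.1 + p.2 | p in B].
pose A : {fset dual R G} := [fset p.1 | p in B].
pose kk : seq I2 := [seq (gamma, alpha) | gamma <- Gam, alpha <- A].
have : \sum_(k <- [seq h i | i <- B]) F k <= \sum_(k <- kk) F k.
  apply: sum_le_subseq => //.
    rewrite map_inj_uniq ?fset_uniq // => p q e.
    have e1 : p.1 = q.1 := congr1 snd e; have : p.1 + p.2 = q.1 + q.2 := congr1 fst e.
    by rewrite e1 => /addrI e2; rewrite (surjective_pairing p) e1 e2 -surjective_pairing.
  move=> _ /mapP[p pB ->]; apply/allpairsP; exists (h p).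
  have hG : p.1 + p.2 \in Gam by apply/imfsetP; exists p.
  have hA : p.1 \in A by apply/imfsetP; exists p.
  by split.
move=> /le_trans; apply.
rewrite big_allpairs_dep /= /F /=.
apply: (@le_trans _ _ (\sum_(gamma <- Gam) C * (cabs (fcoef f gamma) ^+ 2 / lambda gamma))).
  apply: ler_sum => g _; rewrite -mulr_suml.
  have lg := lambda_gt0 g.
  apply: (@le_trans _ _ (C * lambda g * (cabs (fcoef f g) ^+ 2 / lambda g ^+ 2))).
    by rewrite ler_wpM2r ?divr_ge0 ?sqr_ge0.
  rewrite le_eqVlt; apply/orP; left; apply/eqP.
  by field; rewrite gt_eqF.
rewrite -mulr_sumr ler_wpM2l //.
exact: (fsum_le_l2_norm lambda_gt0).
Qed.

Lemma harmonic_rkha_of_subconvolutive : subconvolutive lambda -> is_rkha H ip.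
Proof.
move=> sub; split; first exact: harmonic_rkhs.
exists (harmonic_kernel lambda); first exact: harmonic_kernel_sections.
exists (I2 -> R[i]^o), (l2 lambda2), (l2ip lambda2), harmonic_tensor; split.
  exact: harmonic_tensorP.
have [M hM] := comult_bound sub.
exists comult => [|x].
  split=> [f /hM[]//|k f g hf hg|].
    apply/funext => p; have [_ e] := harmonic_lin lambda_gt0 lambda_sum k hf hg.
    by rewrite /comult e [LHS]mulrDr mulrCA.
  by exists M => f /hM[].
apply/funext => p; rewrite /comult /harmonic_tensor !(fcoef_kernel lambda_gt0 lambda_sum) /kernel_coef /lambda2.
have l0 : (lambda (p.1 + p.2))%:C != 0 :> R[i] by rewrite rc_eq0 gt_eqF.
by rewrite charM conjM rcM rcV rcM; field.
Qed.

(** For a partial sum [S] of the convolution at [gamma], the vectors [v] and [t] satisfy <Delta v,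
    t> = S = |t|^2. Cauchy-Schwarz then gives S <= M^2 |v|^2, and |v|^2 is nearly at most
    [lambda gamma]. *)
Lemma subconvolutive_of_rkha : is_rkha H ip -> subconvolutive lambda.
Proof.
move=> [_ [k hk [L [T [ipT [tau [hT [Delta hD Dk]]]]]]]].
have hH := harmonic_hilbert lambda_gt0 lambda_sum.
have hKe := kernel_sections_unique lambda_gt0 lambda_sum hk.
pose K := harmonic_kernel lambda.
have HK x : H (K x) by have [] := harmonic_kernel_sections lambda_gt0 lambda_sum x.
have hc := harmonic_char lambda_gt0 lambda_sum.
have hTH := tensor_hilbert hT.
have [M hM] := bl_bounded hD.
exists (M ^+ 2) => gamma; apply: esum_le_bound => F.
set S := \sum_(i <- F) _.
have S0 : 0 <= S by rewrite /S sumr_ge0 // => i _; rewrite mulr_ge0 // ltW.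
apply/ler_addgt0Pr => e e0.
(* The error in |v|^2 is later multiplied by [M ^+ 2] and must stay below [e]. *)
have e1 : 0 < e / (M ^+ 2 + 1) by rewrite divr_gt0 //; have := sqr_ge0 M; lra.
have [s s0 hs] := char_avg_isolate gamma (fun g : dual R G => ltW (lambda_gt0 g)) lambda_sum e1.
have n0 : (size s)%:R != 0 :> R[i] by rewrite pnatr_eq0 size_eq0.
pose v := \sum_(x <- s) ((size s)%:R^-1 * gamma x) *: K x.
have hv : H v by apply: (hilbert_sum hH) => x; exact: (hilbertZ hH).
pose ta (alpha : dual R G) := tau (char_fun alpha) (char_fun (gamma - alpha)).
have Tta alpha : T (ta alpha) by apply: (tensor_mem hT); exact: hc.
pose t := \sum_(alpha <- F) (lambda alpha * lambda (gamma - alpha))%:C *: ta alpha.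
have Tt : T t by apply: (hilbert_sum hTH) => alpha; exact: (hilbertZ hTH).
have Dsum (r : seq G) (c : G -> R[i]) :
    Delta (\sum_(x <- r) c x *: K x) = \sum_(x <- r) c x *: tau (K x) (K x).
  elim: r => [|x r IH].
    rewrite !big_nil; have h0 := hilbert_0 hH.
    have := bl_linear hD 1 h0 h0; rewrite !scale1r addr0 => /eqP.
    by rewrite -subr_eq0 opprD addNKr oppr_eq0 => /eqP.
  rewrite !big_cons (bl_linear hD) ?IH //; last first.
    by apply: (hilbert_sum hH) => y; exact: (hilbertZ hH).
  by rewrite -[K x]hKe Dk.
have TK x : T (tau (K x) (K x)) by apply: (tensor_mem hT).
have ipKta x alpha : ipT (tau (K x) (K x)) (ta alpha) = Num.conj (gamma x).
  rewrite (tensor_ip hT) // (ip_conj hH (hc _) (HK x)) (ip_conj hH (hc (gamma - alpha : dual R G)) (HK x)).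
  rewrite !(ip_char_kernel lambda_gt0 lambda_sum) -conjM; congr Num.conj.
  by rewrite -charM addrC subrK.
have Dv_ta alpha : ipT (Delta v) (ta alpha) = 1.
  rewrite Dsum (ip_suml hTH) //.
  under eq_bigr do rewrite ipKta -mulrA char_conj mulr1.
  by rewrite big_const_seq count_predT iter_addr_0 -[LHS]mulr_natr mulVf.
have Dv_t : ipT (Delta v) t = S%:C.
  rewrite (ip_sumr hTH) //; last exact: (bl_map hD).
  under eq_bigr do rewrite Dv_ta mulr1 conj_real.
  by rewrite -(rmorph_sum (real_complex R)).
(* The vectors [ta alpha] are orthogonal, and the coefficient of each in [t] is the inverse of its
   squared norm. *)
have ta_t alpha : alpha \in F -> ipT (ta alpha) t = 1.
  move=> aF; rewrite (ip_sumr hTH) // (bigD1_seq alpha) ?fset_uniq //= big1 => [|b ba].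
    rewrite addr0 conj_real (tensor_ip hT) // !(ip_char lambda_gt0 lambda_sum) !eqxx rcM !mul1r.
    by rewrite -invfM divff // mulf_neq0 // rc_eq0 gt_eqF.
  rewrite (tensor_ip hT) // (ip_char lambda_gt0 lambda_sum) eq_sym (negbTE ba) mul0r mul0r mulr0 //.
have t_t : ipT t t = S%:C.
  rewrite {1}/t (ip_suml hTH) // big_seq (eq_bigr (fun a => (lambda a * lambda (gamma - a))%:C)).
    by rewrite -big_seq -(rmorph_sum (real_complex R)).
  by move=> a aF; rewrite ta_t ?mulr1.
have nt2 : ip_norm ipT t ^+ 2 = S.
  by apply: complexI; rewrite -(ip_normE hTH).
have nv2 : ip_norm ip v ^+ 2 <= lambda gamma + e / (M ^+ 2 + 1).
  have [_ fv] := fcoef_sum lambda_gt0 lambda_sum s (fun x => (size s)%:R^-1 * char_fun gamma x)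
    (hilbert_0 hH) HK.
  have fvE (g : dual R G) : fcoef v g = (lambda g)%:C * char_avg s (gamma - g).
    rewrite fv /char_avg mulrCA mulr_sumr mulr_sumr; apply: eq_bigr => x _.
    rewrite (fcoef_kernel lambda_gt0 lambda_sum) /kernel_coef charM charN; ring.
  set N := lambda gamma + _.
  have N0 : 0 <= N by rewrite addr_ge0 ?ltW.
  rewrite -[leRHS](sqr_sqrtr N0) ler_pXn2r ?nnegrE ?ip_norm_ge0 ?sqrtr_ge0 //.
  apply: (l2_norm_le lambda_gt0 _ _).2 => [|A]; first exact: sqrtr_ge0.
  rewrite sqr_sqrtr //.
  (* The term at [gamma] contributes at most [lambda gamma]. Elsewhere the squared average is at
     most the average in modulus, as this is at most 1, and the choice of [s] bounds the sum. *)
  apply: le_trans (lerD (fsum_single_le gamma A (ltW (lambda_gt0 gamma))) (hs A)).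
  rewrite -big_split; apply: ler_sum => g _ /=.
  have lg := lambda_gt0 g.
  rewrite fvE cabsM exprMn cabs_real ger0_norm ?(ltW lg) // mulrAC expr2 mulfK ?gt_eqF //.
  rewrite -[gamma - g]opprB char_avgN.
  have a0 := cabs_ge0 (char_avg s (g - gamma)); have a1 := char_avg_le1 s (g - gamma).
  have [->|gn] := eqVneq g gamma.
    rewrite mul1r mul0r addr0 -[leRHS]mulr1 ler_wpM2l ?(ltW (lambda_gt0 _)) //.
    by rewrite exprn_ile1 ?cabs_ge0 ?char_avg_le1.
  rewrite mul0r mul1r add0r ler_wpM2l ?(ltW lg) // expr2 -[leRHS]mulr1.
  by rewrite ler_wpM2l.
have CS : S <= M * ip_norm ip v * ip_norm ipT t.
  have := ip_cauchy_schwarz hTH (bl_map hD hv) Tt.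
  rewrite Dv_t cabs_real ger0_norm // => h1; apply: le_trans h1 _.
  by rewrite ler_wpM2r ?ip_norm_ge0 // hM.
have : S <= M ^+ 2 * ip_norm ip v ^+ 2.
  have [->|Sn] := eqVneq S 0; first by rewrite mulr_ge0 ?sqr_ge0.
  have Sp : 0 < S by rewrite lt_def Sn.
  (* Both sides are multiplied by [S], the squared norm of [t], so that the claim becomes the square
     of [CS]. *)
  rewrite -(ler_pM2r Sp) -exprMn -{3}nt2 -exprMn -expr2 ler_pXn2r ?nnegrE //.
  exact: le_trans CS.
have M2 := sqr_ge0 M.
move=> /le_trans; apply.
apply: le_trans (ler_wpM2l M2 nv2) _; rewrite mulrDr lerD2l.
rewrite mulrCA -[leRHS]mulr1 ler_wpM2l ?(ltW e0) // ler_pdivrMr; last lra.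
by rewrite mul1r lerDl.
Qed.

End TensorProduct.

Theorem theorem2p2 (R : realType) (G : topologicalZmodType)
    (lambda : dual R G -> R)
    (G_compact : compact [set: G]) (G_hausdorff : hausdorff_space G)
    (lambda_gt0 : forall gamma : dual R G, 0 < lambda gamma)
    (lambda_L1 :
      (\esum_(gamma in [set: dual R G]) (lambda gamma)%:E < +oo)%E) :
  [/\ is_rkhs (harmonic_space lambda) (harmonic_ip lambda),
      is_kernel_sections (harmonic_space lambda) (harmonic_ip lambda)
        (harmonic_kernel lambda),
      strictly_posdef
        (kernel_fun (harmonic_ip lambda) (harmonic_kernel lambda))
    & is_rkha (harmonic_space lambda) (harmonic_ip lambda)
        <-> subconvolutive lambda].
Proof.
have ls : bounded_sums lambda by apply/esum_ltyP => // gamma; exact: ltW.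
split.
- exact: harmonic_rkhs.
- exact: harmonic_kernel_sections.
- apply: harmonic_strictly_posdef => // u v uv.
  have uv0 : u - v != 0 by rewrite subr_eq0.
  have [c hc cn] := characters_separate R G_compact G_hausdorff uv0.
  (* A character nontrivial at [u - v] takes different values at [u] and [v], being multiplicative
     with nonzero values. *)
  pose gamma : dual R G := SigSub (mem_set hc).
  exists gamma; apply: contra cn => /eqP e.
  have gv : char_fun gamma v != 0 by rewrite -cabs_eq0 cabs_char oner_eq0.
  apply/eqP/(mulIf gv); rewrite mul1r -[c (u - v)]/(char_fun gamma (u - v)).
  by rewrite -char_add subrK.
- split; [exact: subconvolutive_of_rkha|exact: harmonic_rkha_of_subconvolutive].
Qed.
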